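(* Let $q\in(-1,1]$, put $a:=1+q\in(0,2]$, let $0\neq f\in\mathcal{H}$, and let $L_{q,f}$ be the vacuum distribution of the field operator $Q(f)=A(f)+A^+(f)$ on the $(\mathbf{q},2)$-Fock space $\Gamma_{q,2}(\mathcal{H})$. Define $l_{q,f}:\mathbb{R}\to\mathbb{R}$ by $$l_{q,f}(x):=\frac{(1+q)\Vert f\Vert^2}{2\pi}\cdot\frac{\sqrt{4\Vert f\Vert^2-x^2}}{\Vert f\Vert^4+q(q+3)\Vert f\Vert^2x^2-qx^4}\,\chi_{(-2\Vert f\Vert,\,2\Vert f\Vert)}(x),\qquad x\in\mathbb{R}$$ (so $l_{q,f}(x)=0$ for $|x|\ge 2\Vert f\Vert$). Then: 1) for any $q\in\left(-1,\frac12\right]$, $L_{q,f}$ is absolutely continuous (with respect to Lebesgue measure) and $l_{q,f}$ is its probability density function; 2) for any $q\in\left(\frac12,1\right]$, $l_{q,f}$ is not a probability density function, and for every Borel set $B\subset\mathbb{R}$, $$L_{q,f}(B)=\int_B l_{q,f}(x)\,dx+\frac12\left(1-\frac{1+q}{\sqrt{q(q+4)}}\right)\left(\delta_{-2\Vert f\Vert\sqrt{a_1}}+\delta_{2\Vert f\Vert\sqrt{a_1}}\right)(B),$$ where $$a_1:=\frac{\sqrt{(a+2)^2+\frac{4}{a-1}}+a+2}{8}.$$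
   Context: $\mathcal{H}$ is a (complex) Hilbert space of dimension at least $2$ with scalar product $\langle\cdot,\cdot\rangle$, and $q\in[-1,1]$. Let $\langle\cdot,\cdot\rangle_{\otimes n}$ be the standard scalar product on $\mathcal{H}^{\otimes n}$. Define operators $\lambda_1:=\mathbf{1}_{\mathcal{H}}$; $\lambda_2$ on $\mathcal{H}^{\otimes2}$, the linear operator with $\lambda_2(f\otimes g)=f\otimes g+q\,g\otimes f$; and $\lambda_{n+2}:=\mathbf{1}_{\mathcal{H}}^{\otimes n}\otimes\lambda_2$ on $\mathcal{H}^{\otimes(n+2)}$ for $n\ge1$. These are positive. For $n\ge1$ let $\mathcal{H}_n$ be the Hilbert space obtained by quotienting $(\mathcal{H}^{\otimes n},\langle\cdot,\lambda_n\cdot\rangle_{\otimes n})$ by the null space and completing; $\mathcal{H}_0:=\mathbb{C}$. The $(\mathbf{q},2)$-Fock space is $\Gamma_{q,2}(\mathcal{H}):=\bigoplus_{n\ge0}\mathcal{H}_n$, with vacuum vector $\Phi:=1\oplus0\oplus0\oplus\cdots$. For $f\in\mathcal{H}$ the creation operator $A^+(f)$ is the bounded linear operator with $A^+(f)\Phi:=f$ and $A^+(f)F:=f\otimes F$ for $F\in\mathcal{H}_n$, $n\ge1$; the annihilation operator is its adjoint $A(f):=(A^+(f))^*$. Explicitly, $A(f)\Phi=0$, $A(f)g_1=\langle f,g_1\rangle\Phi$, $A(f)(g_1\otimes g_2)=\langle f,g_1\rangle g_2+q\langle f,g_2\rangle g_1$, and $A(f)(g_1\otimes\cdots\otimes g_n)=\langle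 f,g_1\rangle g_2\otimes\cdots\otimes g_n$ for $n>2$. The field operator is $Q(f):=A(f)+A^+(f)$, a bounded self-adjoint operator. The (vacuum) distribution of a bounded self-adjoint operator $X$ is the unique probability measure $\mu$ on $\mathbb{R}$ with $\int x^n\,d\mu=\langle\Phi,X^n\Phi\rangle$ for all $n\in\mathbb{N}=\{0,1,2,\ldots\}$. $\delta_c$ denotes the Dirac measure at $c$ and $\chi_S$ the indicator function of $S$. *)

(* Defs.v *)
From HB Require Import structures.
From mathcomp Require Import all_boot all_order all_algebra sesquilinear.
From mathcomp Require Import complex.
From mathcomp Require Import all_classical all_reals all_analysis.

Set Implicit Arguments.
Unset Strict Implicit.
Unset Printing Implicit Defensive.

Import Order.TTheory GRing.Theory Num.Theory.
Import numFieldNormedType.Exports.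

Local Open Scope classical_set_scope.
Local Open Scope complex_scope.
Local Open Scope ring_scope.

Record hilbertSpace (R : realType) := HilbertSpace {
  hilbert_sort :> completeNormedModType R[i];
  hilbert_dot : {dot hilbert_sort for (@Num.conj R[i])};
  hilbert_dotE : forall x, hilbert_dot x x = `|x| ^+ 2 }.

Section Hilbert.
Context {R : realType}.
Implicit Types E F : hilbertSpace R.

(* The forms of sesquilinear.v are linear on the left; scalar products here are
   linear on the right. *)
Definition inner E (x y : E) : R[i] := hilbert_dot E y x.

(* `|x| lives in R[i]; this is the same norm as an element of R. *)
Definition hnorm E (x : E) : R := complex.Re `|x|.

Definition lin_span E (S : set E) : set E :=
  [set x | exists n (c : 'I_n -> R[i]) (v : 'I_n -> E),
     (forall i, S (v i)) /\ x = \sum_(i < n) c i *: v i].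

Definition dim_ge2 E : Prop :=
  exists u v : E, forall a b : R[i], a *: u + b *: v = 0 -> a = 0 /\ b = 0.

Definition bounded_operator E F (T : E -> F) : Prop :=
  exists M : R, forall x, hnorm (T x) <= M * hnorm x.

Definition is_adjoint E F (T : E -> F) (S : F -> E) : Prop :=
  forall x y, inner (S y) x = inner y (T x).

(* T, with the map (f_1, ..., f_n) |-> f_1 (x) ... (x) f_n, is the Hilbert space
   tensor power of order n of E.  Multilinearity follows from the formula for
   the scalar product.  For n = 0 this says that T is spanned by a unit vector. *)
Definition is_tensor_power E n (T : hilbertSpace R) (tens : n.-tuple E -> T) :=
  (forall s t, inner (tens s) (tens t) =
     \prod_(i < n) inner (tnth s i) (tnth t i)) /\
  dense (lin_span (range tens)).

(* F, with cl : E -> F, is the completion of the quotient of E, with the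
   semi-inner product <x, lam y>, by the null space of the latter. *)
Definition is_quotient_completion E (lam : E -> E) F (cl : {linear E -> F}) :=
  (forall x y, inner (cl x) (cl y) = inner x (lam y)) /\
  dense (range cl).

Definition is_hilbert_sum (Hn : nat -> hilbertSpace R) F
    (inj : forall n, {linear Hn n -> F}) :=
  [/\ forall n (x y : Hn n), inner (inj n x) (inj n y) = inner x y,
      forall m n (x : Hn m) (y : Hn n), m <> n -> inner (inj m x) (inj n y) = 0 &
      dense (lin_span (\bigcup_n range (inj n)))].

End Hilbert.

(* Hilbert tensor powers, quotient-completions and Hilbert sums are unique up to
   unitary isomorphism only, so the record ranges over all their realizations.
   In degree 0 the tensor power, hence also the level, is a copy of the complex
   numbers, with the empty tensor as 1. *)
Record fockSpace (R : realType) (q : R) (H : hilbertSpace R) := FockSpace {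
  tpow : nat -> hilbertSpace R;
  tens : forall n, n.-tuple H -> tpow n;
  tensP : forall n, is_tensor_power (@tens n);

  lam : forall n, {linear tpow n -> tpow n};
  lam_bounded : forall n, bounded_operator (lam n);
  lam0 : forall x, lam 0 x = x;
  lam1 : forall x, lam 1 x = x;
  (* 1^{(x) n} (x) lam_2, where lam_2 (g (x) h) = g (x) h + q h (x) g *)
  lam_tens : forall n (s : n.-tuple H) (g h : H),
    lam n.+2 (tens [tuple of rcons (rcons s g) h]) =
    tens [tuple of rcons (rcons s g) h] +
      q%:C *: tens [tuple of rcons (rcons s h) g];

  level : nat -> hilbertSpace R;
  level_cl : forall n, {linear tpow n -> level n};
  level_clP : forall n, is_quotient_completion (lam n) (level_cl n);

  fock_sort :> hilbertSpace R;
  fock_inj : forall n, {linear level n -> fock_sort};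
  fock_injP : is_hilbert_sum fock_inj }.

Section Operators.
Context {R : realType} {q : R} {H : hilbertSpace R} (G : fockSpace q H).

(* s_1 (x) ... (x) s_n, as a vector of the Fock space *)
Definition fock_tens n (s : n.-tuple H) : G := fock_inj G n (level_cl G n (tens G s)).

Definition vacuum : G := fock_tens [tuple].

(* Classes of simple tensors span a dense subspace of each level, so that a
   bounded linear operator is determined by these values. *)
Definition is_creation (f : H) (Ap : {linear G -> G}) : Prop :=
  [/\ bounded_operator Ap,
      Ap vacuum = fock_tens [tuple f] &
      forall n (s : n.+1.-tuple H),
        Ap (fock_tens s) = fock_tens [tuple of f :: s]].

Definition is_vacuum_distribution (X : G -> G)
    (L : probability (measurableTypeR R) R) : Prop :=
  forall n : nat,
    L.-integrable setT (EFin \o (fun x : measurableTypeR R => x ^+ n)) /\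
    (\int[L]_x (x ^+ n))%:C = inner vacuum (iter n X vacuum).

End Operators.

Section Density.
Context {R : realType}.
Notation mu := (@lebesgue_measure R).

Definition is_pdf (p : R -> R) : Prop :=
  [/\ measurable_fun [set: measurableTypeR R] p,
      forall x, 0 <= p x &
      (\int[mu]_x (p x)%:E = 1)%E].

Definition is_density_of (L : probability (measurableTypeR R) R) (p : R -> R) :=
  is_pdf p /\
  forall B, measurable B -> L B = (\int[mu]_(x in B) (p x)%:E)%E.

Definition l_density (q : R) (H : hilbertSpace R) (f : H) (x : R) : R :=
  (1 + q) * hnorm f ^+ 2 / (2 * pi) *
  (Num.sqrt (4 * hnorm f ^+ 2 - x ^+ 2) /
   (hnorm f ^+ 4 + q * (q + 3) * hnorm f ^+ 2 * x ^+ 2 - q * x ^+ 4)) *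
  \1_(`](- (2 * hnorm f)), (2 * hnorm f)[) x.

Definition a1 (q : R) : R :=
  let a := 1 + q in
  (Num.sqrt ((a + 2) ^+ 2 + 4 / (a - 1)) + a + 2) / 8.

End Density.

(* Main.v *)
Require Import Defs.
From HB Require Import structures.
From mathcomp Require Import all_boot all_order all_algebra sesquilinear.
From mathcomp Require Import complex.
From mathcomp Require Import all_classical all_reals all_analysis.
From mathcomp Require Import measurable_realfun.
From mathcomp Require Import ring lra.

Set Implicit Arguments.
Unset Strict Implicit.
Unset Printing Implicit Defensive.

Import Order.TTheory GRing.Theory Num.Theory.
Import numFieldNormedType.Exports.

Local Open Scope classical_set_scope.
Local Open Scope ring_scope.

(* The vectors f^(x)n span an invariant subspace on which Q(f) is a Jacobi
   matrix with zero diagonal and squared weights b, (1+q) b, b, b, ... where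
   b = |f|^2, so the monic polynomials P_n of this matrix are orthogonal for L.
   With U_n the Chebyshev polynomials of the interval [-2 |f|, 2 |f|] and D the
   quartic denominator of the density, D U_n is a combination of P_n, P_(n+2)
   and P_(n+4) (of P_1, P_3, P_5 if n = 1, of P_0, P_4 if n = 0), whence
   E_L(D U_n) = 0 for n > 0: the moments of D L are those of a multiple of the
   semicircle law.  As L has bounded support, this gives
   L(B \ {D = 0}) = int_B l.  D has no real zero if q <= 0, and the zeros +-c
   with c = 2 |f| sqrt(a_1) if q > 0; the mass of L at each of them is the
   inverse of the sum over n of P_n(c)^2 / |P_n|^2, which from n = 2 on is a
   geometric series, of ratio < 1 if and only if q > 1/2. *)

(** * The field operator on the powers of a vector *)

(** [L] is known only through expectations of polynomials, and E(D p) says nothing about [L] where D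
    vanishes. To divide by D, p is taken to be a polynomial approximation of 1/D times one of the
    indicator of a half-line. D times the former tends to the indicator of D <> 0, boundedly on the
    support, so dominated convergence turns the identity of moments into an identity of measures off
    the zeros of D. Both approximations are explicit iterations. For an atom at c let K_n be the
    Christoffel-Darboux kernel at c. E(K_n^2) = K_n(c) gives L{c} <= 1 / K_n(c) at once. The
    converse must exclude that K_n^2 L accumulates near c without charging c: (X - c) K_n involves
    only P_n and P_(n+1), so it tends to 0 in L^2 when q > 1/2, and c is then isolated in the
    support, since it lies outside [-2 |f|, 2 |f|]. *)

Section InnerTheory.
Context {R : realType}.
Implicit Types E F : hilbertSpace R.

Lemma innerC E (x y : E) : inner x y = (inner y x)^*.
Proof. by rewrite /inner hermC expr0 mul1r. Qed.

Lemma innerDr E (x y z : E) : inner x (y + z) = inner x y + inner x z.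
Proof. by rewrite /inner linearDl. Qed.

Lemma innerZr E (a : R[i]) (x y : E) : inner x (a *: y) = a * inner x y.
Proof. by rewrite /inner linearZl_LR. Qed.

Lemma innerBr E (x y z : E) : inner x (y - z) = inner x y - inner x z.
Proof. by rewrite /inner linearBl. Qed.

Lemma innerBl E (x y z : E) : inner (y - z) x = inner y x - inner z x.
Proof. by rewrite /inner linearB. Qed.

Lemma innerZl E (a : R[i]) (x y : E) : inner (a *: x) y = a^* * inner x y.
Proof. by rewrite /inner linearZr_LR. Qed.

Lemma innerE E (x : E) : inner x x = `|x| ^+ 2.
Proof. exact: hilbert_dotE. Qed.

Lemma inner_extl E (x y : E) : (forall z, inner z x = inner z y) -> x = y.
Proof.
move=> xy; apply/eqP; rewrite -subr_eq0 -normr_eq0 -sqrf_eq0 -innerE.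
by rewrite innerBr xy subrr.
Qed.

Lemma hnormE E (x : E) : `|x| = (hnorm x)%:C%C.
Proof. by rewrite /hnorm RRe_real// ger0_real. Qed.

Lemma cauchy_schwarz E (x y : E) : `|inner x y| <= `|x| * `|y|.
Proof.
have [->|y0] := eqVneq y 0.
  by rewrite -[X in inner x X](subrr x) innerBr subrr !normr0 mulr0.
have ny : `|y| != 0 by rewrite normr_eq0.
pose a := inner y x / `|y| ^+ 2.
have ry : (`|y| ^+ 2)^* = `|y| ^+ 2 by rewrite -innerE -innerC.
have : inner (x - a *: y) (x - a *: y) = `|x| ^+ 2 - `|inner x y| ^+ 2 / `|y| ^+ 2.
  rewrite innerBl !innerBr !innerZl !innerZr !innerE normCK.
  rewrite /a rmorphM fmorphV /= ry -[(inner y x)^*]innerC.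
  rewrite -[(inner x y)^*]innerC.
  by field.
rewrite innerE => e.
have : 0 <= `|x - a *: y| ^+ 2 by rewrite exprn_ge0.
rewrite e subr_ge0 ler_pdivrMr ?exprn_gt0 ?lt_def ?ny//= -exprMn.
by rewrite ler_pXn2r ?nnegrE ?mulr_ge0.
Qed.

(** Used once for each closure in the construction of the Fock space: Hilbert sum,
    quotient-completion, tensor power. *)
Lemma additive_eq0_dense E (S : set E) (F : E -> R[i]) (M : R[i]) :
  dense S -> (forall x y, F (x - y) = F x - F y) ->
  (forall x, `|F x| <= M * `|x|) ->
  (forall x, S x -> F x = 0) -> forall x, F x = 0.
Proof.
move=> dS FB FM FS x; apply/eqP; rewrite -normr_eq0; apply/negPn/negP => Fx0.
have Fx_gt0 : 0 < `|F x| by rewrite lt_def Fx0/=.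
have M0 : 0 < M.
  have := lt_le_trans Fx_gt0 (FM x).
  have [->|x0] := eqVneq x 0; first by rewrite normr0 mulr0 ltxx.
  by rewrite pmulr_lgt0// normr_gt0.
have e0 : 0 < `|F x| / M by rewrite divr_gt0.
have [||y [yx Sy]] := dS (ball x (`|F x| / M)).
- by exists x; exact: ballxx.
- exact: ball_open.
- have := FM (x - y); rewrite FB (FS y)// subr0 => h.
  move: yx; rewrite -ball_normE /ball_/= ltr_pdivlMr// mulrC.
  by move/(le_lt_trans h); rewrite ltxx.
Qed.


Lemma inner0r E (x : E) : inner x 0 = 0.
Proof. by rewrite -[0](subrr (0 : E)) innerBr subrr. Qed.

Lemma inner_sumr E n (c : 'I_n -> R[i]) (v : 'I_n -> E) (y : E) :
  inner y (\sum_(i < n) c i *: v i) = \sum_(i < n) c i * inner y (v i).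
Proof.
elim/big_rec2: _ => [|i a b _ <-]; first exact: inner0r.
by rewrite innerDr innerZr.
Qed.

End InnerTheory.

Section FockTheory.
Context {R : realType} {q : R} {H : hilbertSpace R} (G : fockSpace q H).

Lemma normr_fock_inj n (x : level G n) : `|fock_inj G n x| = `|x|.
Proof.
have [iE _ _] := fock_injP G.
by apply/eqP; rewrite -(@eqrXn2 _ 2)// -!innerE iE.
Qed.

(** The three closures are undone from the outside in. Boundedness of [lam] makes [level_cl]
    continuous, so that density of simple tensors passes from the tensor power to the level. *)
Lemma fock_tens_total (v : G) :
  (forall n (s : n.-tuple H), inner (fock_tens G s) v = 0) -> v = 0.
Proof.
move=> sv0; have v0 n (s : n.-tuple H) : inner v (fock_tens G s) = 0.
  by rewrite innerC sv0 rmorph0. apply: inner_extl => x; rewrite inner0r.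
rewrite innerC; apply/eqP; rewrite conjC_eq0; apply/eqP; move: x.
have [iE i0 idense] := fock_injP G.
apply: (additive_eq0_dense (M := `|v|) idense).
- by move=> x y; rewrite innerBr.
- exact: cauchy_schwarz.
move=> _ [k [c [u [uS ->]]]].
rewrite inner_sumr big1// => i _; have [n _ [y _ <-]] := uS i.
suff -> : inner v (fock_inj G n y) = 0 by rewrite mulr0.
move: y; have [clE cldense] := level_clP G n.
apply: (additive_eq0_dense (M := `|v|) cldense).
- by move=> x y; rewrite linearB innerBr.
- by move=> x; rewrite -(normr_fock_inj x); exact: cauchy_schwarz.
move=> _ [t _ <-]; move: t.
have [tE tdense] := tensP G n; have [M lamM] := lam_bounded G n.
(* The square of the left side is <t, lam t>, at most C |t|^2. As C = 1 + |M| is at least 1, C <=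
   C^2 and the same C survives the square root. *)
have cl_le t : `|level_cl G n t| <= (1 + `|M|)%:C%C * `|t|.
  have M0 : 0 <= (1 + `|M|)%:C%C :> R[i] by rewrite ler0c addr_ge0.
  rewrite -(@ler_pXn2r _ 2)// ?nnegrE ?mulr_ge0// -innerE clE.
  have : `|lam G n t| <= (1 + `|M|)%:C%C * `|t|.
    rewrite !hnormE -rmorphM lecR (le_trans (lamM t))//; apply: ler_wpM2r.
      by rewrite -ler0c -hnormE.
    by rewrite (le_trans (ler_norm _))// lerDr.
  move=> lamt; rewrite -[leLHS]ger0_norm; last by rewrite -clE innerE exprn_ge0.
  apply: (le_trans (cauchy_schwarz _ _)).
  apply: (le_trans (ler_wpM2l _ lamt)) => //.
  rewrite mulrCA -expr2 exprMn; apply: ler_wpM2r; first exact: exprn_ge0.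
  by rewrite ler_eXnr// lecR lerDl.
apply: (additive_eq0_dense (M := `|v| * (1 + `|M|)%:C%C) tdense).
- by move=> x y; rewrite !linearB innerBr.
- move=> x; rewrite (le_trans (cauchy_schwarz _ _))// -mulrA ler_wpM2l//.
  by rewrite normr_fock_inj.
move=> _ [m [d [w [wS ->]]]]; rewrite !linear_sum/=.
under eq_bigr do rewrite !linearZ/=.
rewrite inner_sumr big1// => j _; have [s _ <-] := wS j.
by rewrite v0 mulr0.
Qed.

(** The eigenvalue of [lam] at a power of one vector: exchanging the last two factors fixes that
    power. *)
Definition tens_weight (n : nat) : R := if n is k.+2 then 1 + q else 1.

Definition fock_pow (f : H) n : G := fock_tens G [tuple of nseq n f].

Lemma lam_nseq (f : H) n :
  lam G n (tens G [tuple of nseq n f]) =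
  (tens_weight n)%:C%C *: tens G [tuple of nseq n f].
Proof.
case: n => [|[|n]]; rewrite ?lam0 ?lam1 ?scale1r//.
have -> : [tuple of nseq n.+2 f] = [tuple of rcons (rcons [tuple of nseq n f] f) f].
  by apply: val_inj => /=; rewrite -!cats1 -catA -[[:: f] ++ _]/(nseq 2 f) -nseqD addn2.
by rewrite lam_tens -{1}[tens _ _]scale1r -scalerDl rmorphD rmorph1.
Qed.

Lemma inner_fock_tens_pow (f : H) n (s : n.-tuple H) :
  inner (fock_tens G s) (fock_pow f n) =
  (tens_weight n)%:C%C * \prod_(i < n) inner (tnth s i) f.
Proof.
have [iE _ _] := fock_injP G; have [clE _] := level_clP G n.
rewrite iE clE lam_nseq innerZr (tensP G n).1; congr (_ * _).
by apply: eq_bigr => i _; rewrite [in X in inner _ X](tnth_nth f) nth_nseq ltn_ord.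
Qed.

Lemma inner_fock_tens_neq m n (s : m.-tuple H) (t : n.-tuple H) :
  m <> n -> inner (fock_tens G s) (fock_tens G t) = 0.
Proof. by have [_ + _] := fock_injP G; exact. Qed.

(** For b = |f|^2, the quotients |f^(n+1)|^2 / |f^n|^2, where |f^n|^2 is [tens_weight n] times b^n;
    the factor 1 + q enters once, between degrees 1 and 2. *)
Definition jacobi_weight (b : R) (n : nat) : R :=
  match n with 0 => b | 1 => (1 + q) * b | _ => b end.

Variables (f : H) (Ap : {linear G -> G}) (A : G -> G).
Hypotheses (Ap_creation : is_creation f Ap) (A_adjoint : is_adjoint Ap A).
Let b : R := hnorm f ^+ 2.

Lemma inner_adjointr x y : inner x (A y) = inner (Ap x) y.
Proof. by rewrite innerC A_adjoint -innerC. Qed.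

Lemma adjointD x y : A (x + y) = A x + A y.
Proof.
by apply: inner_extl => z; rewrite innerDr !inner_adjointr innerDr.
Qed.

Lemma adjointZ (c : R[i]) x : A (c *: x) = c *: A x.
Proof.
by apply: inner_extl => z; rewrite innerZr !inner_adjointr innerZr.
Qed.

Lemma creation_tens n (s : n.-tuple H) :
  Ap (fock_tens G s) = fock_tens G [tuple of f :: s].
Proof.
have [_ Ap0 ApS] := Ap_creation.
case: n s => [s|n s]; last by rewrite ApS.
by rewrite (tuple0 s) [LHS]Ap0; congr fock_tens; exact: val_inj.
Qed.

Lemma creation_pow n : Ap (fock_pow f n) = fock_pow f n.+1.
Proof. by rewrite creation_tens; congr fock_tens; exact: val_inj. Qed.

Lemma annihilation_vacuum : A (vacuum G) = 0.
Proof.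
apply: fock_tens_total => n s.
by rewrite inner_adjointr creation_tens inner_fock_tens_neq.
Qed.

(** Both sides are tested against simple tensors, [A] becoming [Ap] on the other side. Only degree n
    contributes, and the additional first factor yields <f, f> = b. *)
Lemma annihilation_pow n :
  A (fock_pow f n.+1) = (jacobi_weight b n)%:C%C *: fock_pow f n.
Proof.
apply/eqP; rewrite -subr_eq0; apply/eqP/fock_tens_total => m s.
rewrite innerBr inner_adjointr creation_tens innerZr.
have [mn|/eqP mn] := eqVneq m n; last first.
  by rewrite !inner_fock_tens_neq ?mulr0 ?subrr// => -[].
move: s; rewrite mn => s.
rewrite !inner_fock_tens_pow big_ord_recl tnth0 innerE hnormE.
under eq_bigr do rewrite tnthS.
apply/eqP; rewrite subr_eq0; apply/eqP; rewrite !mulrA; congr (_ * _).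
rewrite -!rmorphM; congr (_%:C)%C.
by case: n {s mn} => [|[|n]] /=; rewrite /b; ring.
Qed.

Definition field_op (x : G) : G := A x + Ap x.

Lemma field_opB x y : field_op (x - y) = field_op x - field_op y.
Proof.
rewrite /field_op linearB/= -[- y]scaleN1r adjointD adjointZ scaleN1r.
by rewrite addrACA opprD.
Qed.

Lemma field_opZ c x : field_op (c *: x) = c *: field_op x.
Proof. by rewrite /field_op adjointZ linearZ/= scalerDr. Qed.

Lemma field_op_iterB m x y :
  iter m field_op (x - y) = iter m field_op x - iter m field_op y.
Proof. by elim: m => //= m ->; rewrite field_opB. Qed.

Lemma field_op_iterZ m c x : iter m field_op (c *: x) = c *: iter m field_op x.
Proof. by elim: m => //= m ->; rewrite field_opZ. Qed.

Lemma field_op_pow0 : field_op (fock_pow f 0) = fock_pow f 1.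
Proof.
rewrite -creation_pow /field_op (_ : A _ = 0) ?add0r// -annihilation_vacuum.
by congr (A (fock_tens _ _)); exact: val_inj.
Qed.

Lemma field_op_powS n :
  field_op (fock_pow f n.+1) =
  fock_pow f n.+2 + (jacobi_weight b n)%:C%C *: fock_pow f n.
Proof. by rewrite /field_op annihilation_pow creation_pow addrC. Qed.

End FockTheory.

(** * Orthogonal polynomials of a Jacobi matrix *)

Section OrthogonalPolynomials.
Context {R : realFieldType}.
Variable om : nat -> R.

Fixpoint opoly (n : nat) : {poly R} :=
  match n with
  | 0 => 1
  | n1.+1 => match n1 with
             | 0 => 'X
             | n2.+1 => 'X * opoly n1 - om n2 *: opoly n2
             end
  end.

Arguments opoly : simpl never.

Lemma opolySS n : opoly n.+2 = 'X * opoly n.+1 - om n *: opoly n.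
Proof. by []. Qed.

Lemma mulX_opolyS n : 'X * opoly n.+1 = opoly n.+2 + om n *: opoly n.
Proof. by rewrite opolySS subrK. Qed.

Definition opoly_norm (n : nat) : R := \prod_(i < n) om i.

Lemma opoly_norm0 : opoly_norm 0 = 1.
Proof. by rewrite /opoly_norm big_ord0. Qed.

Lemma opoly_normS n : opoly_norm n.+1 = om n * opoly_norm n.
Proof. by rewrite /opoly_norm big_ord_recr /= mulrC. Qed.

Variable phi : {poly R} -> R.
Hypothesis phi_scalar : scalar phi.

Let phi0 : phi 0 = 0.
Proof. by have := phi_scalar (-1) 0 0; rewrite scaler0 addr0 mulN1r addNr. Qed.

Lemma scalar_formD p r : phi (p + r) = phi p + phi r.
Proof. by have := phi_scalar 1 p r; rewrite scale1r mul1r. Qed.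

Lemma scalar_formZ c p : phi (c *: p) = c * phi p.
Proof. by have := phi_scalar c p 0; rewrite phi0 !addr0. Qed.

Lemma scalar_formB p r : phi (p - r) = phi p - phi r.
Proof. by rewrite -scaleN1r scalar_formD scalar_formZ mulN1r. Qed.

Lemma scalar_form_sum n (F : 'I_n -> {poly R}) :
  phi (\sum_(i < n) F i) = \sum_(i < n) phi (F i).
Proof.
by elim/big_rec2: _ => [//|i x y _ <-]; rewrite scalar_formD.
Qed.

Hypothesis phi_opoly : forall n, phi (opoly n) = (n == 0)%:R.

(** Multiplication by X replaces P_n by P_(n+1) + om P_(n-1), at the cost of a factor of at most 1 +
    W. For n = 0 this bounds the moments, hence the support. *)
Lemma scalar_form_bound W m n : (forall k, `|om k| <= W) ->
  `|phi ('X^m * opoly n)| <= (1 + W) ^+ m.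
Proof.
move=> omW; have W0 : 0 <= W by rewrite (le_trans _ (omW 0)).
elim: m n => [n|m IH n].
  by rewrite expr0 mul1r phi_opoly expr0; case: (n == _); rewrite ?normr1 ?normr0.
rewrite exprSr -mulrA; case: n => [|n].
  have -> : 'X * opoly 0 = opoly 1 by rewrite mulr1.
  apply: (le_trans (IH 1)); rewrite exprS.
  by apply: ler_peMl; [rewrite exprn_ge0// addr_ge0|rewrite lerDl].
rewrite mulX_opolyS mulrDr -scalerAr scalar_formD scalar_formZ.
rewrite (le_trans (ler_normD _ _))// normrM exprS mulrDl mul1r lerD//.
by rewrite ler_pM.
Qed.

(** Moving X from one factor to the other expresses row m + 2 by rows m + 1 and m, whence the
    induction on two consecutive rows. For m = k + 1 the two surviving terms cancel. *)
Lemma opoly_orthogonal m n :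
  phi (opoly m * opoly n) = (m == n)%:R * opoly_norm n.
Proof.
have H0 k : phi (opoly 0 * opoly k) = (0 == k)%:R * opoly_norm k.
  by rewrite mul1r phi_opoly eq_sym; case: eqP => [<-|_]; rewrite ?opoly_norm0 ?mul1r ?mul0r.
suff : (forall k, phi (opoly m * opoly k) = (m == k)%:R * opoly_norm k) /\
  (forall k, phi (opoly m.+1 * opoly k) = (m.+1 == k)%:R * opoly_norm k) by case.
elim: m {n} => [|m [IH0 IH1]]; split => //.
  case=> [|k]; first by rewrite mulr1 phi_opoly mul0r.
  rewrite mulX_opolyS scalar_formD scalar_formZ !phi_opoly add0r opoly_normS.
  case: k => [|k]; first by rewrite opoly_norm0 mulr1 mul1r.
  by rewrite mulr0 mul0r.
case=> [|k].
  rewrite mulr1 phi_opoly mul0r//.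
rewrite opolySS mulrBl scalar_formB -scalerAl scalar_formZ IH0.
rewrite -mulrA mulrCA mulX_opolyS mulrDr scalar_formD -scalerAr scalar_formZ !IH1.
rewrite !eqSS [opoly_norm k.+1]opoly_normS.
have [->|mk] := eqVneq m k.+1.
  rewrite !opoly_normS gtn_eqF; last by rewrite ltnS leqnSn.
  by rewrite !mul0r mulr0 addr0 !mul1r subrr.
by rewrite !mul0r mulr0 subr0 add0r mulrCA.
Qed.

(** Agreement on all ['X^m * opoly n] replaces an expansion of [p] in the basis of the P_n. *)
Lemma scalar_form_ext (psi : {poly R} -> R) : scalar psi ->
  (forall n, phi (opoly n) = psi (opoly n)) -> forall p, phi p = psi p.
Proof.
move=> psi_scalar eq_op p.
have agree m n : phi ('X^m * opoly n) = psi ('X^m * opoly n).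
  elim: m n => [n|m IH n]; first by rewrite mul1r.
  rewrite exprSr -mulrA; case: n => [|n].
    by rewrite -[_ * opoly 0]/('X * 1) mulr1; exact: (IH 1).
  rewrite mulX_opolyS mulrDr -scalerAr addrC phi_scalar psi_scalar.
  by rewrite !IH.
suff : forall m, phi ('X^m * p) = psi ('X^m * p) by move/(_ 0%N); rewrite mul1r.
elim/poly_ind: p => [|p c IH] m.
  rewrite mulr0 phi0; have := psi_scalar (-1) 0 0.
  by rewrite scaler0 addr0 mulN1r addNr.
have -> : 'X^m * (p * 'X + c%:P) = c *: ('X^m * opoly 0) + 'X^(m.+1) * p.
  by rewrite mulr1 -mul_polyC exprS; ring.
by rewrite phi_scalar psi_scalar agree IH.
Qed.

Variable (c : R).

(** The Christoffel-Darboux kernel: it reproduces the value at [c] of polynomials of degree at most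
    n, for the scalar product phi(p r). *)
Definition opoly_kernel n : {poly R} :=
  \sum_(k < n.+1) ((opoly k).[c] / opoly_norm k) *: opoly k.

Hypothesis om_gt0 : forall n, 0 < om n.

Lemma opoly_norm_gt0 n : 0 < opoly_norm n.
Proof. exact: prodr_gt0. Qed.

Lemma opoly_kernelE n :
  (opoly_kernel n).[c] = \sum_(k < n.+1) (opoly k).[c] ^+ 2 / opoly_norm k.
Proof.
rewrite /opoly_kernel horner_sum; apply: eq_bigr => k _.
by rewrite hornerZ expr2 mulrAC.
Qed.

Lemma scalar_form_kernel_opoly n k : (k <= n)%N ->
  phi (opoly_kernel n * opoly k) = (opoly k).[c].
Proof.
move=> kn; rewrite /opoly_kernel mulr_suml scalar_form_sum.
have kn1 : (k < n.+1)%N by [].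
rewrite (bigD1 (Ordinal kn1))//= big1 ?addr0; last first.
  move=> i ik; rewrite -scalerAl scalar_formZ opoly_orthogonal.
  by rewrite (_ : (_ == _) = false) ?mul0r ?mulr0//; apply/negbTE.
rewrite -scalerAl scalar_formZ opoly_orthogonal eqxx mul1r mulrVK//.
by rewrite unitfE gt_eqF// opoly_norm_gt0.
Qed.

(** Thus K_n / K_n(c) has value 1 at [c] and its square has expectation 1 / K_n(c): it is the test
    function that bounds an atom from above. *)
Lemma scalar_form_kernel_sqr n :
  phi (opoly_kernel n ^+ 2) = (opoly_kernel n).[c].
Proof.
rewrite expr2 {2}/opoly_kernel mulr_sumr scalar_form_sum opoly_kernelE.
apply: eq_bigr => k _; rewrite -scalerAr scalar_formZ.
by rewrite scalar_form_kernel_opoly -1?ltnS// expr2 mulrAC.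
Qed.

Lemma christoffel_darboux n :
  ('X - c%:P) * opoly_kernel n =
  (opoly_norm n)^-1 *: ((opoly n).[c] *: opoly n.+1 - (opoly n.+1).[c] *: opoly n).
Proof.
elim: n => [|n IH].
  rewrite /opoly_kernel big_ord1 /opoly_norm big_ord0 /= hornerC hornerX.
  by rewrite divr1 invr1 !scale1r mulr1 alg_polyC.
have n0 k := lt0r_neq0 (opoly_norm_gt0 k).
rewrite /opoly_kernel big_ord_recr/= mulrDr -/(opoly_kernel n) IH opoly_normS.
rewrite !opolySS hornerD hornerN hornerM hornerX hornerZ.
have om0 := lt0r_neq0 (om_gt0 n).
rewrite -!mul_polyC.
have -> : ((opoly n.+1).[c] / (om n * opoly_norm n))%:P =
  (om n)^-1%:P * (opoly_norm n)^-1%:P * (opoly n.+1).[c]%:P :> {poly R}.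
  by rewrite -!polyCM; congr (_%:P); field; rewrite om0 n0.
have -> : (om n * opoly_norm n)^-1%:P = (om n)^-1%:P * (opoly_norm n)^-1%:P :> {poly R}.
  by rewrite -polyCM invfM.
rewrite polyCB !polyCM.
have : (om n)^-1%:P * (om n)%:P = 1 :> {poly R} by rewrite -polyCM mulVf.
move: (opoly n) (opoly n.+1) (opoly n).[c]%:P (opoly n.+1).[c]%:P.
move: (opoly_norm n)^-1%:P (om n)^-1%:P (om n)%:P => h i o u v y z io.
(* Inserting [i * o = 1] gives the term from the induction hypothesis the factor 1 / om n of the
   others, so that the claim becomes a polynomial identity. *)
have -> : h * (y * v - z * u) = i * o * h * (y * v - z * u) by rewrite io mul1r.
ring.
Qed.

(** Measures how far K_n is from being an eigenvector, at [c], of multiplication by X. The cross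
    term of the square vanishes by orthogonality. *)
Lemma scalar_form_christoffel_darboux n :
  phi ((('X - c%:P) * opoly_kernel n) ^+ 2) =
  ((opoly n).[c] ^+ 2 * opoly_norm n.+1 + (opoly n.+1).[c] ^+ 2 * opoly_norm n) /
  opoly_norm n ^+ 2.
Proof.
rewrite christoffel_darboux exprZn scalar_formZ mulrC exprVn; congr (_ / _).
set u := (opoly n).[c]; set v := (opoly n.+1).[c].
have -> : (u *: opoly n.+1 - v *: opoly n) ^+ 2 =
  u ^+ 2 *: (opoly n.+1 * opoly n.+1) + v ^+ 2 *: (opoly n * opoly n)
  - (u * v *+ 2) *: (opoly n * opoly n.+1).
  by rewrite -!mul_polyC !(polyCM, polyCMn, polyC_exp); ring.
rewrite scalar_formB scalar_formD !scalar_formZ !opoly_orthogonal !eqxx.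
by rewrite (ltn_eqF (ltnSn n)) mul0r mulr0 subr0 !mul1r.
Qed.

End OrthogonalPolynomials.

(** * The denominator of the density *)

Section Denominator.
Context {R : realType}.
Variables (q b : R).

Local Notation P := (opoly (@jacobi_weight R q b)).
Local Notation U := (opoly (fun=> b)).

(** Origin of D: b D = P_3^2 - x P_2 P_3 + b P_2^2. Hence D(x) = 0 means that P_3(x) / P_2(x) is a
    root of t^2 - x t + b, that is, that the P_n(x) form a geometric sequence from n = 2 on. *)
Definition denom_poly : {poly R} :=
  (b ^+ 2)%:P + (q * (q + 3) * b)%:P * 'X^2 - q%:P * 'X^4.

Lemma horner_denom_poly x :
  denom_poly.[x] = b ^+ 2 + q * (q + 3) * b * x ^+ 2 - q * x ^+ 4.
Proof. by rewrite /denom_poly !hornerE. Qed.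

Lemma denom_poly_chebyshev0 : denom_poly * U 0 = ((1 + q) * b ^+ 2) *: P 0 - q *: P 4.
Proof.
rewrite mulr1 !opolySS /opoly /= /denom_poly -!mul_polyC.
by rewrite !(polyCM, polyCD, polyC_exp); ring.
Qed.

Lemma denom_poly_chebyshev1 :
  denom_poly * U 1 =
  ((1 + q) * b ^+ 2) *: P 1 - (q * b) *: P 3 - q *: P 5.
Proof.
rewrite !opolySS /opoly /= /denom_poly -!mul_polyC.
by rewrite !(polyCM, polyCD, polyC_exp); ring.
Qed.

(** From index 2 on all weights equal b, so both sides satisfy the same recurrence and only two base
    cases are computed. *)
Lemma denom_poly_chebyshevSS n :
  denom_poly * U n.+2 =
  b ^+ 2 *: P n.+2 - (q * b) *: P n.+4 - q *: P n.+2.+4.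
Proof.
suff : denom_poly * U n.+2 =
  b ^+ 2 *: P n.+2 - (q * b) *: P n.+4 - q *: P n.+2.+4 /\
  denom_poly * U n.+3 =
  b ^+ 2 *: P n.+3 - (q * b) *: P n.+3.+2 - q *: P n.+3.+4 by case.
elim: n => [|n [IH0 IH1]].
  rewrite !opolySS /opoly /= /denom_poly -!mul_polyC.
  by rewrite !(polyCM, polyCD, polyC_exp); split; ring.
split=> //; rewrite [U n.+4]opolySS mulrBr mulrCA -scalerAr IH1 IH0.
rewrite [P n.+4.+4]opolySS [P n.+4.+2]opolySS [P n.+4 in RHS]opolySS /=.
rewrite -!mul_polyC.
move: (P n.+2) (P n.+3) (P n.+4) (P n.+3.+2) (P n.+2.+4) (P n.+3.+4).
by move=> *; ring.
Qed.

Lemma scalar_form_denom_chebyshev (phi : {poly R} -> R) n :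
  scalar phi -> (forall n, phi (P n) = (n == 0)%:R) ->
  phi (denom_poly * U n) = (1 + q) * b ^+ 2 * (n == 0)%:R.
Proof.
move=> phi_scalar phiP; case: n => [|[|n]].
- rewrite denom_poly_chebyshev0 scalar_formB// !scalar_formZ// !phiP.
  by rewrite !mulr0 subr0.
- rewrite denom_poly_chebyshev1 !scalar_formB// !scalar_formZ// !phiP.
  by rewrite !mulr0 !subr0.
- rewrite denom_poly_chebyshevSS !scalar_formB// !scalar_formZ// !phiP.
  by rewrite !mulr0 !subr0.
Qed.

(* In the variable x = 2 sqrt(b) cos t this is the differential equation of
   the Chebyshev polynomials of the second kind. *)
Lemma chebyshev_deriv n :
  ((4 * b)%:P - 'X^2) * (U n.+1)^`() =
  (2 * n.+2%:R * b) *: U n - n.+1%:R *: ('X * U n.+1).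
Proof.
suff : ((4 * b)%:P - 'X^2) * (U n.+1)^`() =
    (2 * n.+2%:R * b) *: U n - n.+1%:R *: ('X * U n.+1) /\
  ((4 * b)%:P - 'X^2) * (U n.+2)^`() =
    (2 * n.+3%:R * b) *: U n.+1 - n.+2%:R *: ('X * U n.+2) by case.
elim: n => [|n [IH0 IH1]].
  rewrite opolySS /opoly /= derivB derivM derivZ !derivX derivC -!mul_polyC.
  by rewrite !polyCM !polyC_natr; split; ring.
split=> //; rewrite [U n.+3]opolySS derivB derivM derivZ derivX.
have distr (e u x d c d' : {poly R}) :
  e * (1 * u + x * d - c * d') = e * u + x * (e * d) - c * (e * d') by ring.
rewrite -[b *: _^`()]mul_polyC distr IH1 IH0 [U n.+2]opolySS.
rewrite -!mul_polyC !polyCM !polyC_natr.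
by move: (U n) (U n.+1) => u v; ring.
Qed.

Hypothesis b_gt0 : 0 < b.

(** The square is completed in x^2. For -1 < q < 0 the subtracted term is negative, so D > 0; for q
    > 0 it is a square, which gives the zeros. *)
Lemma denom_poly_lt0E x :
  - 4 * q * denom_poly.[x] =
  (2 * q * x ^+ 2 - q * (q + 3) * b) ^+ 2 - q * (q + 1) ^+ 2 * (q + 4) * b ^+ 2.
Proof. by rewrite horner_denom_poly; ring. Qed.

(** A certificate of positivity for q >= 0 and x^2 < 4 b. At x^2 = 4 b only the middle term is left:
    D vanishes at the ends of the interval exactly when q = 1/2. *)
Lemma denom_poly_ge0E x :
  4 * denom_poly.[x] =
  b * (4 * b - x ^+ 2) + b * x ^+ 2 * (1 - 2 * q) ^+ 2
  + 4 * q * x ^+ 2 * (4 * b - x ^+ 2).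
Proof. by rewrite horner_denom_poly; ring. Qed.

Lemma denom_poly_gt0 x : -1 < q <= 1 -> q <= 0 \/ x ^+ 2 < 4 * b ->
  0 < denom_poly.[x].
Proof.
move=> /andP[q1 q2] H.
have [q0|q0] := eqVneq q 0.
  by rewrite horner_denom_poly q0 !mul0r addr0 subr0 exprn_gt0.
have [qlt0|qge0] := ltP q 0.
  rewrite -(pmulr_rgt0 _ (_ : 0 < - 4 * q)); last by rewrite nmulr_rgt0//; lra.
  rewrite denom_poly_lt0E ltr_wpDl ?sqr_ge0//.
  rewrite oppr_gt0 -!mulrA nmulr_rlt0// !mulr_gt0 ?exprn_gt0//; lra.
have xb : x ^+ 2 < 4 * b by case: H => // H; move: q0; rewrite eq_le H qge0.
rewrite -(pmulr_rgt0 _ (_ : 0 < 4))// denom_poly_ge0E.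
have b0 := ltW b_gt0.
have h1 : 0 < b * (4 * b - x ^+ 2) by rewrite mulr_gt0// subr_gt0.
have h2 : 0 <= b * x ^+ 2 * (1 - 2 * q) ^+ 2.
  have := sqr_ge0 x; have := sqr_ge0 (1 - 2 * q).
  by move: (x ^+ 2) (_ ^+ 2) => u v v0 u0; rewrite !mulr_ge0.
have h3 : 0 <= 4 * q * x ^+ 2 * (4 * b - x ^+ 2).
  move: xb (sqr_ge0 x); move: (x ^+ 2) => u ub u0.
  by rewrite !mulr_ge0// subr_ge0 ltW.
lra.
Qed.

(** * Orthogonal polynomials at a zero of the denominator *)

Section ValuesAtRoot.
Variables (z c : R).
Hypotheses (z_gt0 : 0 < z) (zE : q * z * (z + 1) = 1).
Hypothesis c_sqr : c ^+ 2 = b * (z + 1) ^+ 2 / z.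
(** A root of t^2 - c t + b, the characteristic equation of the recurrence with constant weight b;
    the other root is c / (z + 1). *)
Let rho := c * z / (z + 1).

Let z0 : z != 0. Proof. exact: lt0r_neq0. Qed.
Let z1 : z + 1 != 0. Proof. by rewrite gt_eqF// addr_gt0. Qed.
Let b0 : b != 0. Proof. exact: lt0r_neq0. Qed.

Let qE : q = (z * (z + 1))^-1.
Proof. by apply: (mulIf (mulf_neq0 z0 z1)); rewrite mulrA zE mulVf// mulf_neq0. Qed.

Let q_gt0 : 0 < q.
Proof. by rewrite qE invr_gt0 mulr_gt0// addr_gt0. Qed.

Let q1 : 1 + q != 0. Proof. by rewrite gt_eqF// addr_gt0. Qed.

Let rho2 : rho ^+ 2 = b * z.
Proof. by rewrite /rho !exprMn exprVn c_sqr; field; exact/andP. Qed.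

Let crho : c * rho = b + b * z.
Proof.
have -> : c * rho = c ^+ 2 * z / (z + 1) by rewrite /rho; ring.
by rewrite c_sqr; field; exact/andP.
Qed.

Let c_sqrB : c ^+ 2 - b = (1 + q) * b * (1 + z).
Proof. by rewrite c_sqr {1}qE; field; exact/andP. Qed.

(** The equation q z (z + 1) = 1 is what gives P_3(c) = rho P_2(c); the recurrence then keeps the
    sequence in the mode rho. *)
Lemma opoly_rootSS n : (P n.+2).[c] = (c ^+ 2 - b) * rho ^+ n.
Proof.
suff : (P n.+2).[c] = (c ^+ 2 - b) * rho ^+ n /\
  (P n.+3).[c] = (c ^+ 2 - b) * rho ^+ n.+1 by case.
elim: n => [|n [IH0 IH1]].
  have P2 : (P 2).[c] = c ^+ 2 - b by rewrite opolySS /opoly /= !hornerE; ring.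
  split; rewrite ?P2 ?expr0 ?mulr1//.
  rewrite [P 3]opolySS hornerD hornerN hornerM hornerX hornerZ P2 hornerX expr1.
  rewrite [jacobi_weight _ _]/((1 + q) * b).
  have -> : c * (c ^+ 2 - b) - (1 + q) * b * c = c * (c ^+ 2 - b - (1 + q) * b) by ring.
  by rewrite c_sqrB /rho qE; field; exact/andP.
split => //; rewrite opolySS hornerD hornerN hornerM hornerX hornerZ IH0 IH1 /=.
have -> : rho ^+ n.+2 = (c * rho - b) * rho ^+ n.
  by rewrite crho addrAC subrr add0r -rho2 -exprD.
by rewrite [rho ^+ n.+1]exprS; ring.
Qed.

Lemma opoly_norm_jacobiSS n :
  opoly_norm (@jacobi_weight R q b) n.+2 = (1 + q) * b ^+ n.+2.
Proof.
elim: n => [|n IH].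
  by rewrite /opoly_norm !big_ord_recr big_ord0 /=; ring.
by rewrite opoly_normS IH /= [b ^+ n.+3]exprS; ring.
Qed.

Lemma opoly_root_sqrSS n :
  (P n.+2).[c] ^+ 2 / opoly_norm (@jacobi_weight R q b) n.+2 =
  (1 + q) * (1 + z) ^+ 2 * z ^+ n.
Proof.
rewrite opoly_rootSS opoly_norm_jacobiSS exprMn -exprM mulnC exprM.
rewrite rho2 c_sqrB.
have bn : b ^+ n != 0 by rewrite expf_neq0.
rewrite [(b * z) ^+ n]exprMn -[n.+2]addn2 exprD; field.
by rewrite ?q1 ?b0 ?bn ?q1.
Qed.

Lemma kernel_root n :
  (opoly_kernel (@jacobi_weight R q b) c n.+1).[c] =
  1 + (z + 1) ^+ 2 / z + \sum_(j < n) (1 + q) * (1 + z) ^+ 2 * z ^+ j.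
Proof.
rewrite opoly_kernelE !big_ord_recl /= addrA; congr (_ + _).
  rewrite /opoly_norm big_ord1 big_ord0 /opoly /= hornerC hornerX c_sqr.
  by field; rewrite z0 b0.
by apply: eq_bigr => j _; rewrite opoly_root_sqrSS.
Qed.

Lemma kernel_root_ge n : 1 <= z ->
  n%:R <= (opoly_kernel (@jacobi_weight R q b) c n.+1).[c].
Proof.
move=> z_ge1; rewrite kernel_root.
have h : n%:R <= \sum_(j < n) (1 + q) * (1 + z) ^+ 2 * z ^+ j.
  rewrite -[n in n%:R]card_ord -sumr_const.
  apply: ler_sum => j _; have zj : 1 <= z ^+ j by rewrite exprn_ege1.
  have h2 : 1 <= 1 + q by rewrite lerDl ltW.
  have h3 : 1 <= (1 + z) ^+ 2 by rewrite exprn_ege1// lerDl ltW.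
  by apply: mulr_ege1 => //; apply: mulr_ege1.
have y0 : 0 <= (z + 1) ^+ 2 / z.
  by apply: divr_ge0; [exact: sqr_ge0|exact: ltW].
lra.
Qed.

(** The limit is the inverse of the weight found in [atom_weightE]. *)
Lemma kernel_root_cvg : z < 1 ->
  (opoly_kernel (@jacobi_weight R q b) c n.+1).[c] @[n --> \oo] -->
  (4 * z + 2) / (z * (1 - z)).
Proof.
move=> z_lt1; have z_neq1 : 1 - z != 0 by rewrite subr_eq0 gt_eqF.
have -> : (4 * z + 2) / (z * (1 - z)) =
  1 + (z + 1) ^+ 2 / z + (1 + q) * (1 + z) ^+ 2 / (1 - z).
  by rewrite qE; field; rewrite z0 z1 z_neq1.
under eq_cvg do rewrite kernel_root.
apply: cvgD; first exact: cvg_cst.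
have := @cvg_geometric_series R ((1 + q) * (1 + z) ^+ 2) z.
rewrite ger0_norm ?ltW// => /(_ z_lt1); apply: cvg_trans.
apply: near_eq_cvg; near=> n; rewrite /series /= big_mkord.
by apply: eq_bigr => j _.
Unshelve. all: end_near.
Qed.

Lemma christoffel_darboux_root_cvg : z < 1 ->
  ((P n).[c] ^+ 2 * opoly_norm (@jacobi_weight R q b) n.+1 +
   (P n.+1).[c] ^+ 2 * opoly_norm (@jacobi_weight R q b) n) /
  opoly_norm (@jacobi_weight R q b) n ^+ 2 @[n --> \oo] --> (0 : R).
Proof.
move=> z_lt1; rewrite -(cvg_shiftn 2)/=.
have hn n : opoly_norm (@jacobi_weight R q b) n != 0.
  by apply/lt0r_neq0/opoly_norm_gt0 => -[|[|k]] //=; rewrite mulr_gt0// addr_gt0.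
(* The quotient is b times the sum of two consecutive terms (1 + q) (1 + z)^2 z^n and (1 + q) (1 +
   z)^2 z^(n+1), which gives the third factor 1 + z. *)
have geo : geometric (b * (1 + q) * (1 + z) ^+ 3) z @ \oo --> (0 : R).
  by apply: cvg_geometric; rewrite ger0_norm// ltW.
apply: cvg_trans geo; apply: near_eq_cvg; near=> n; rewrite addn2 /geometric /=.
have e1 := opoly_root_sqrSS n; have e2 := opoly_root_sqrSS n.+1.
have h : opoly_norm (@jacobi_weight R q b) n.+3 = b * opoly_norm (@jacobi_weight R q b) n.+2.
  exact: opoly_normS.
set h2 := opoly_norm _ n.+2 in e1 h *; set h3 := opoly_norm _ n.+3 in e2 h *.
have h20 : h2 != 0 by exact: hn.
transitivity (b * ((P n.+2).[c] ^+ 2 / h2) + b * ((P n.+3).[c] ^+ 2 / h3)).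
  by rewrite e1 e2 [z ^+ n.+1]exprS; ring.
by rewrite h; field; rewrite h20 b0.
Unshelve. all: end_near.
Qed.

End ValuesAtRoot.

(** * Closed forms for the zeros and for the weight of the atoms *)

Section Roots.
Hypotheses (q_gt0 : 0 < q) (q_le1 : q <= 1).

Local Notation s := (Num.sqrt (q * (q + 4))).

Lemma sqr_root_disc : s ^+ 2 = q * (q + 4).
Proof. by have q0 := ltW q_gt0; rewrite sqr_sqrtr// mulr_ge0 ?addr_ge0. Qed.

(* The positive root z of q z^2 + q z = 1: the zeros of the denominator are the
   points x = rho + b / rho with rho^2 = b z. *)
Definition decay_ratio : R := (s - q) / (2 * q).
Local Notation z := decay_ratio.

Lemma root_disc_gt : q < s.
Proof.
rewrite -(@ltr_pXn2r _ 2)// ?nnegrE ?sqrtr_ge0 ?ltW// sqr_root_disc.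
by rewrite expr2 ltr_pM2l//; lra.
Qed.

Lemma decay_ratio_gt0 : 0 < z.
Proof. by rewrite divr_gt0 ?subr_gt0 ?root_disc_gt// mulr_gt0. Qed.

Lemma decay_ratioE : q * z * (z + 1) = 1.
Proof.
have h := sqr_root_disc; have q0 := lt0r_neq0 q_gt0.
have -> : q * z * (z + 1) = (s ^+ 2 - q ^+ 2) / (4 * q).
  by rewrite /decay_ratio; field.
by rewrite h; field.
Qed.

Lemma decay_ratioV : z^-1 = q * (z + 1).
Proof.
have z0 := lt0r_neq0 decay_ratio_gt0.
by apply: (mulfI z0); rewrite mulfV// mulrCA mulrA decay_ratioE.
Qed.

Lemma root_discE : s = q * (2 * z + 1).
Proof. by have q0 := lt0r_neq0 q_gt0; rewrite /decay_ratio; field. Qed.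

(** z (z + 1) = 1 / q, and t (t + 1) increases on t > 0 with value 2 at t = 1. *)
Lemma decay_ratio_lt1 : (z < 1) = (1 / 2 < q).
Proof.
have h := decay_ratioE; have z0 := decay_ratio_gt0; have q0 := q_gt0.
by apply/idP/idP => h1; nra.
Qed.

(** With a - 1 = q, the radicand in [a1] is the square of (q + 1) (2 z + 1). The right side is (z +
    1)^2 / z, so that 4 b a1 is the square of rho + b / rho. *)
Lemma a1E : 4 * a1 q = z + 2 + z^-1.
Proof.
have q0 := lt0r_neq0 q_gt0; have z0 := decay_ratio_gt0; have h := decay_ratioE.
have zz : z * (z + 1) = q^-1.
  by apply: (mulfI q0); rewrite mulrA h mulfV.
have zV := decay_ratioV.
rewrite /a1 /=.
have -> : (1 + q + 2) ^+ 2 + 4 / (1 + q - 1) = ((q + 1) * (2 * z + 1)) ^+ 2.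
  have -> : ((q + 1) * (2 * z + 1)) ^+ 2 = (q + 1) ^+ 2 * (4 * (z * (z + 1)) + 1).
    by ring.
  have -> : 1 + q - 1 = q by ring.
  by rewrite zz; field.
have qz : 0 <= (q + 1) * (2 * z + 1) by have := q_gt0; nra.
rewrite sqrtr_sqr ger0_norm//.
by rewrite zV; field.
Qed.

Lemma a1_ge0 : 0 <= a1 q.
Proof.
have z0 := decay_ratio_gt0; have zV0 : 0 < z^-1 by rewrite invr_gt0.
have := a1E; lra.
Qed.

(** D has two zeros as a polynomial in x^2; the other sign of the square root would give x^2 = - b
    z^2 / (z + 1) < 0. *)
Lemma denom_poly_eq0 x : denom_poly.[x] = 0 -> x ^+ 2 = b * (4 * a1 q).
Proof.
have q0 := lt0r_neq0 q_gt0; have z0 := decay_ratio_gt0; have h := decay_ratioE.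
have zV := decay_ratioV.
move=> D0; rewrite a1E zV.
have := denom_poly_lt0E x; rewrite D0 mulr0 => /esym/eqP.
have -> : q * (q + 1) ^+ 2 * (q + 4) * b ^+ 2 = ((q + 1) * s * b) ^+ 2.
  by rewrite !exprMn sqr_root_disc; ring.
rewrite subr_eq0 eqf_sqr root_discE => /orP[] /eqP e.
  by apply: (mulfI q0); apply: (mulfI (_ : 2 != 0 :> R)) => //; lra.
have : q * x ^+ 2 * (z + 1) = - q * b * z ^+ 2.
  have -> : q * x ^+ 2 = q * b * (1 - z - q * z) by lra.
  have -> : q * b * (1 - z - q * z) * (z + 1) =
    q * b * ((1 - z) * (z + 1)) - q * b * (q * z * (z + 1)) by ring.
  by rewrite h; ring.
have : 0 <= q * x ^+ 2 * (z + 1).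
  apply: mulr_ge0; last exact: addr_ge0 (ltW z0) ler01.
  exact: mulr_ge0 (ltW q_gt0) (sqr_ge0 x).
have : 0 < q * b * z ^+ 2 by exact: mulr_gt0 (mulr_gt0 q_gt0 b_gt0) (exprn_gt0 2 z0).
lra.
Qed.

Lemma atom_weightE : 1 / 2 * (1 - (1 + q) / s) = z * (1 - z) / (4 * z + 2).
Proof.
have z0 := decay_ratio_gt0; have z1 : 0 < z + 1 by rewrite addr_gt0.
have qE : q = (z * (z + 1))^-1.
  by rewrite invfM decay_ratioV -mulrA mulfV ?mulr1// gt_eqF.
rewrite root_discE; move: z z0 z1 qE => y y0 y1 ->.
have y2 : 0 < 2 * y + 1 by rewrite addr_gt0// mulr_gt0.
have y4 : 0 < 4 * y + 2 by rewrite addr_gt0// mulr_gt0.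
by field; rewrite !gt_eqF.
Qed.

End Roots.

End Denominator.

(** * The semicircle law *)

Section WeightedIntegral.
Context {R : realType}.
Variables (mu : {measure set (measurableTypeR R) -> \bar R}).
Variables (D : set (measurableTypeR R)) (mD : measurable D) (w : R -> R).
Hypothesis int_pow : forall n,
  mu.-integrable D (EFin \o (fun x : measurableTypeR R => x ^+ n * w x)).

Lemma integrable_horner (p : {poly R}) :
  mu.-integrable D (EFin \o (fun x : measurableTypeR R => p.[x] * w x)).
Proof.
suff H n : mu.-integrable D (EFin \o (fun x : measurableTypeR R => x ^+ n * p.[x] * w x)).
  by have := H 0%N; apply: eq_integrable => // x _ /=; rewrite expr0 mul1r.
elim/poly_ind: p n => [|p c IH] n.
  apply: eq_integrable (integrable0 mu D) => // x _ /=.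
  by rewrite horner0 mulr0 mul0r.
have := integrableD mD (IH n.+1) (integrableZl mD c (int_pow n)).
apply: eq_integrable => // x _ /=; rewrite -EFinM -EFinD; congr EFin.
by rewrite hornerMXaddC exprS; ring.
Qed.

(** Measure and weight are parameters because this form serves both for the semicircle law and, with
    weight 1, for [L]. *)
Definition poly_integral (p : {poly R}) : R := \int[mu]_(x in D) (p.[x] * w x).

Lemma poly_integral_scalar : scalar poly_integral.
Proof.
move=> c p r; rewrite /poly_integral.
rewrite -RintegralZl//; last exact: integrable_horner.
rewrite -RintegralD//; last exact: integrable_horner.
  by apply: eq_Rintegral => x _; rewrite hornerD hornerZ; ring.
have := integrableZl mD c (integrable_horner p).
by apply: eq_integrable.
Qed.

End WeightedIntegral.

Section Semicircle.
Context {R : realType}.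
Variable b : R.
Hypothesis b_gt0 : 0 < b.
Notation mu := (@lebesgue_measure R).
Let N := Num.sqrt b.
Let I : set (measurableTypeR R) := `[- (2 * N), 2 * N].
Let w (x : R) := Num.sqrt (4 * b - x ^+ 2).

Lemma continuous_semicircle : continuous w.
Proof.
move=> x; apply: continuous_comp; last exact: sqrt_continuous.
apply: cvgB; first exact: cvg_cst.
exact: exprn_continuous.
Qed.

Lemma semicircle_integrable n :
  mu.-integrable I (EFin \o (fun x : measurableTypeR R => x ^+ n * w x)).
Proof.
apply: continuous_compact_integrable; first exact: segment_compact.
apply: continuous_subspaceT => x.
apply: cvgM; [exact: exprn_continuous|exact: continuous_semicircle].
Qed.

Local Notation J := (poly_integral mu I w).

Lemma Rintegral_FTC2 (f F : R -> R) (x y : R) : x < y ->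
  continuous f -> continuous F ->
  {in `]x, y[, forall t, is_derive t (1 : R) F (f t)} ->
  \int[mu]_(t in `[x, y]) f t = F y - F x.
Proof.
move=> xy cf cF dF; rewrite /Rintegral (continuous_FTC2 (F := F) xy)//.
- exact: continuous_subspaceT.
- split; [|exact/cvg_at_right_filter/cF|exact/cvg_at_left_filter/cF].
  by move=> t txy; have [] := dF t txy.
- by move=> t txy; rewrite derive1E; have [] := dF t txy.
Qed.

Let N_gt0 : 0 < N. Proof. by rewrite sqrtr_gt0. Qed.
Let sqrN : N ^+ 2 = b. Proof. by rewrite sqr_sqrtr// ltW. Qed.

Let end_lt : - (2 * N) < 2 * N.
Proof. by rewrite gtrN// mulr_gt0. Qed.

(** The integrand is the derivative of p (4 b - x^2)^(3/2), which vanishes at both ends. *)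
Lemma semicircle_by_parts (p : {poly R}) :
  J (((4 * b)%:P - 'X^2) * p^`() - 3 *: ('X * p)) = 0.
Proof.
rewrite /poly_integral.
rewrite (@Rintegral_FTC2 _ (fun x => (p * ((4 * b)%:P - 'X^2)).[x] * w x))//.
- have w2 : w (2 * N) = 0.
    by rewrite /w exprMn sqrN (_ : _ - _ = 0) ?sqrtr0//; ring.
  have w2' : w (- (2 * N)) = 0 by rewrite -w2 /w sqrrN.
  by rewrite w2 w2' !mulr0 subrr.
- move=> x; apply: cvgM; [exact: continuous_horner|exact: continuous_semicircle].
- move=> x; apply: cvgM; [exact: continuous_horner|exact: continuous_semicircle].
move=> x; rewrite in_itv/= => /andP[x1 x2].
have wx : 0 < 4 * b - x ^+ 2 by rewrite -sqrN; nra.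
have w0 : w x != 0 by rewrite gt_eqF// sqrtr_gt0.
have w2 : w x ^+ 2 = 4 * b - x ^+ 2 by rewrite sqr_sqrtr// ltW.
pose r : {poly R} := (4 * b)%:P - 'X^2.
have rE y : r.[y] = 4 * b - y ^+ 2 by rewrite /r !hornerE.
have drE : r^`().[x] = - (2 * x).
  by rewrite /r derivB derivC derivXn sub0r !hornerE /=; ring.
have dw : is_derive x (1 : R) w (- x / w x).
  have wE : w = Num.sqrt \o (horner r) by apply/funext => y; rewrite /= rE.
  rewrite [X in is_derive _ _ X _]wE.
  have rx : 0 < r.[x] by rewrite rE.
  apply: is_derive_eq (is_derive1_comp (is_derive1_sqrt rx) (is_derive_poly r x)) _.
  by rewrite rE -/(w x) drE; field.
apply: is_derive_eq (is_deriveM (is_derive_poly (p * r) x) dw) _.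
rewrite -/r; clearbody r.
rewrite derivM !hornerE drE rE -w2 /GRing.scale /=.
by field.
Qed.

Lemma semicircle_area : J 1 = 2 * pi * b.
Proof.
have pi2 : - (pi / 2) < pi / 2 :> R by rewrite gtrN// divr_gt0// pi_gt0.
pose F (t : R) : R := 2 * N * sin t.
have dF (t : R) : is_derive t (1 : R) F (2 * N * cos t).
  apply: is_derive_eq (is_deriveZ (2 * N) (is_derive_sin t)) _.
  by [].
have F'E : (F^`())%classic = (fun t => 2 * N * cos t).
  by apply/funext => t; rewrite derive1E; have [] := dF t.
have F'c : continuous (F^`())%classic.
  by rewrite F'E => t; apply: cvgM; [exact: cvg_cst|exact: continuous_cos].
have Fc : continuous F.
  by move=> t; apply: cvgM; [exact: cvg_cst|exact: continuous_sin].
have E1 : I = `[F (- (pi / 2)), F (pi / 2)]%classic.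
  by rewrite /I /F sinN sin_pihalf mulrN mulr1.
have wF t : t \in `[- (pi / 2), pi / 2] -> w (F t) * (F^`())%classic t = 4 * b * cos t ^+ 2.
  rewrite in_itv => /= ht; have ct : 0 <= cos t by rewrite cos_ge0_pihalf.
  rewrite F'E /w /F.
  have -> : 4 * b - (2 * N * sin t) ^+ 2 = (2 * N * cos t) ^+ 2.
    rewrite !exprMn sqrN.
    by have := cos2Dsin2 t; move: (cos t ^+ 2) (sin t ^+ 2) => u v e; nra.
  rewrite sqrtr_sqr ger0_norm; last by rewrite !mulr_ge0// ltW.
  by rewrite -sqrN; ring.
rewrite /poly_integral /Rintegral.
have -> : (\int[mu]_(x in I) ((1 : {poly R}).[x] * w x)%:E =
   \int[mu]_(t in `[(- (pi / 2))%R, (pi / 2)%R]) (4 * b * cos t ^+ 2)%:E)%E.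
  transitivity (\int[mu]_(x in I) (w x)%:E)%E.
    by apply: eq_integral => x _; rewrite hornerC mul1r.
  rewrite E1 integration_by_substitution_increasing ?ltW//.
  - by apply: eq_integral => t; rewrite inE/= => ht; rewrite -wF.
  - by move=> s t hs ht st; rewrite /F ltr_pM2l ?mulr_gt0// ltr_sin.
  - by apply/cvg_ex; exists ((F^`())%classic (- (pi / 2))); exact/cvg_at_right_filter/F'c.
  - by apply/cvg_ex; exists ((F^`())%classic (pi / 2)); exact/cvg_at_left_filter/F'c.
  - by split=> //; [apply/cvg_at_right_filter/Fc|apply/cvg_at_left_filter/Fc].
  - by apply: continuous_subspaceT; exact: continuous_semicircle.
transitivity (\int[mu]_(t in `[(- (pi / 2)), (pi / 2)]) (4 * b * cos t ^+ 2)); first by [].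
rewrite (@Rintegral_FTC2 _ (fun t => 2 * b * (t + sin t * cos t)))//.
- by rewrite sinN cosN cos_pihalf; field.
- move=> t; apply: (@cvgM R R); first exact: cvg_cst.
  apply: (@continuous_comp _ _ _ cos (fun u : R => u ^+ 2)).
    exact: continuous_cos.
  exact: exprn_continuous.
- move=> t; apply: cvgM; first exact: cvg_cst.
  apply: cvgD; first exact: cvg_id.
  by apply: cvgM; [exact: continuous_sin|exact: continuous_cos].
move=> t _.
apply: is_derive_eq (is_deriveZ (2 * b) (is_deriveD (is_derive_id t 1)
  (is_deriveM (is_derive_sin t) (is_derive_cos t)))) _.
rewrite /GRing.scale /=; have := cos2Dsin2 t.
move: (cos t) (sin t) => u v e.
have -> : v * - v = u ^+ 2 - 1 by rewrite -e; ring.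
ring.
Qed.

(** Integration by parts for U_(k+1) and its differential equation give (k + 4) J(U_(k+2)) = k b
    J(U_k). The factor k stops the nonzero J(U_0) from reaching J(U_2). *)
Lemma semicircle_chebyshev n :
  J (opoly (fun=> b) n) = 2 * pi * b * (n == 0%N)%:R.
Proof.
have Js := poly_integral_scalar (measurable_itv _) semicircle_integrable.
have rec k : (k%:R + 4) * J (opoly (fun=> b) k.+2) = k%:R * b * J (opoly (fun=> b) k).
  have := semicircle_by_parts (opoly (fun=> b) k.+1).
  rewrite chebyshev_deriv.
  have -> : 'X * opoly (fun=> b) k.+1 = opoly (fun=> b) k.+2 + b *: opoly (fun=> b) k.
    by rewrite opolySS subrK.
  rewrite !(scalar_formB Js, scalar_formD Js, scalar_formZ Js).
  have -> : k.+2%:R = k%:R + 2 :> R by rewrite -addn2 natrD.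
  have -> : k.+1%:R = k%:R + 1 :> R by rewrite -addn1 natrD.
  by move: (J _) (J _) => u v; lra.
have k4 k : k%:R + 4 != 0 :> R by rewrite gt_eqF// ltr_wpDl.
have J1 : J (opoly (fun=> b) 1) = 0.
  have := semicircle_by_parts 1; rewrite mulr1 derivC mulr0 sub0r -scaleNr.
  by rewrite (scalar_formZ Js) => /eqP; rewrite mulf_eq0 oppr_eq0 pnatr_eq0 => /eqP.
case: n => [|n]; first by rewrite mulr1 -semicircle_area.
rewrite mulr0; suff [] : J (opoly (fun=> b) n.+1) = 0 /\ J (opoly (fun=> b) n.+2) = 0 by [].
elim: n => [|n [IH0 IH1]]; split => //.
  by apply: (mulfI (k4 0%N)); rewrite rec !mul0r mulr0.
by apply: (mulfI (k4 n.+1)); rewrite rec IH0 !mulr0.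
Qed.

End Semicircle.

(** * From polynomials to measures *)

(** The proofs of measurability and positivity are arguments so that the measure structure declared
    below can be inferred from the term. *)
Definition density_measure {R : realType} (f : R -> R)
    (mf : measurable_fun [set: measurableTypeR R] f) (f_ge0 : forall x, 0 <= f x)
    (V : set (measurableTypeR R)) : \bar R :=
  (\int[@lebesgue_measure R]_(x in V) (f x)%:E)%E.

Section DensityMeasure.
Context {R : realType}.
Variables (f : R -> R) (mf : measurable_fun [set: measurableTypeR R] f).
Hypothesis f_ge0 : forall x, 0 <= f x.

Let density_measure0 : density_measure mf f_ge0 set0 = 0%E.
Proof. exact: integral_set0. Qed.

Let density_measure_ge0 V : (0 <= density_measure mf f_ge0 V)%E.
Proof. by apply: integral_ge0 => x _; rewrite lee_fin. Qed.

Let density_measure_sigma_additive : semi_sigma_additive (density_measure mf f_ge0).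
Proof.
move=> /= F mF tF mUF; rewrite /density_measure; apply: cvg_toP.
  apply: ereal_nondecreasing_is_cvgn => m n mn.
  apply: lee_sum_nneg_natr => // k _ _; apply: integral_ge0 => /= x Fkx.
  by rewrite lee_fin.
rewrite ge0_integral_bigcup//=.
- by apply: (measurable_funS measurableT) => //; exact/measurable_EFinP.
- by move=> x _; rewrite lee_fin.
Qed.

HB.instance Definition _ := isMeasure.Build _ _ _ (density_measure mf f_ge0)
  density_measure0 density_measure_ge0 density_measure_sigma_additive.

(** Open right half-lines generate the Borel sets, are stable under intersection and exhaust the
    line. *)
Lemma measure_eq_density (m : {measure set (measurableTypeR R) -> \bar R}) :
  (m setT < +oo)%E ->
  (forall c, m `]c, +oo[%classic =
     \int[@lebesgue_measure R]_(x in `]c, +oo[) (f x)%:E)%E ->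
  forall B, measurable B ->
    m B = (\int[@lebesgue_measure R]_(x in B) (f x)%:E)%E.
Proof.
move=> mfin mE.
pose g n : set (measurableTypeR R) := `](- n%:R), +oo[%classic.
move=> B mB; rewrite -[RHS]/(density_measure mf f_ge0 B).
apply: (@measure_unique _ R (measurableTypeR R) (@RGenOInfty.G R) g) mB.
- exact: RGenOInfty.measurableE.
- move=> _ _ [x ->] [y ->]; exists (Num.max x y).
  by apply/seteqP; split => z /=; rewrite !in_itv/= !andbT gt_max => /andP.
- by move=> n; exists (- n%:R).
- apply/seteqP; split => // x _.
  exists (Num.truncn `|x|).+1 => //; rewrite /g/= in_itv/= andbT ltrNl.
  by apply: le_lt_trans (truncnS_gt _); rewrite -normrN ler_norm.
- by move=> _ [x ->]; exact: mE.
- move=> n; apply: le_lt_trans mfin.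
  by apply: le_measure; rewrite ?inE//; exact: measurable_itv.
Qed.

End DensityMeasure.

(** * Polynomial approximation of half-lines *)

Section SignPolynomials.
Context {R : realType}.
Variables (c T : R).
Hypothesis T_gt0 : 0 < T.

(* On [-1, 1] the iterates of y |-> y (3 - y^2) / 2 converge to the sign of y. *)
Fixpoint sign_poly n : {poly R} :=
  if n is k.+1 then 2^-1 *: (sign_poly k * (3%:P - sign_poly k ^+ 2))
  else T^-1 *: ('X - c%:P).

Lemma horner_sign_polyS n x :
  (sign_poly n.+1).[x] =
  (sign_poly n).[x] * (3 - (sign_poly n).[x] ^+ 2) / 2.
Proof.
by rewrite /= hornerZ hornerM hornerD hornerN hornerC horner_exp mulrC.
Qed.

Lemma horner_sign_poly0 x : (sign_poly 0).[x] = (x - c) / T.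
Proof. by rewrite /= hornerZ hornerXsubC mulrC. Qed.

(** One iteration multiplies the distance 1 - y by (1 - y) (2 + y) / 2 <= 1 - y / 2. As the iterates
    stay above their starting value, this factor is bounded uniformly in n. *)
Lemma sign_poly_gt0 n x : c < x <= c + T ->
  (x - c) / T <= (sign_poly n).[x] <= 1 /\
  1 - (sign_poly n).[x] <= (1 - (x - c) / T / 2) ^+ n.
Proof.
move=> /andP[cx xT].
have y0 : 0 < (x - c) / T by rewrite divr_gt0// subr_gt0.
have y1 : (x - c) / T <= 1 by rewrite ler_pdivrMr// mul1r; lra.
elim: n => [|n [/andP[IH1 IH2] IH3]].
  by rewrite horner_sign_poly0 lexx y1 expr0; split=> //; lra.
rewrite horner_sign_polyS; move: IH1 IH2 IH3.
move: (sign_poly n).[x] ((x - c) / T) y0 y1 => s y y0 y1 h1 h2 h3.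
have e : 1 - s * (3 - s ^+ 2) / 2 = (1 - s) * ((1 - s) * (2 + s) / 2) by field.
split; first (apply/andP; split; first nra).
  rewrite -subr_ge0 e !mulr_ge0//; lra.
rewrite e exprSr; apply: ler_pM => //; [lra|nra|nra].
Qed.

Lemma sign_poly_sym n x : (sign_poly n).[c - x] = - (sign_poly n).[c + x].
Proof.
elim: n => [|n IH]; first by rewrite !horner_sign_poly0; ring.
by rewrite !horner_sign_polyS IH; ring.
Qed.

Lemma sign_poly_bound n x : `|x - c| <= T -> `|(sign_poly n).[x]| <= 1.
Proof.
move=> xT.
have bound y : 0 <= y <= T -> `|(sign_poly n).[c + y]| <= 1.
  rewrite le_eqVlt => /andP[/predU1P[<-|y0] yT].
    suff -> : (sign_poly n).[c + 0] = 0 by rewrite normr0.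
    have := sign_poly_sym n 0; rewrite subr0 addr0; lra.
  have [|/andP[h1 h2] _] := @sign_poly_gt0 n (c + y).
    by rewrite ltrDl y0 lerD2l.
  rewrite ger0_norm//; apply: le_trans h1.
  by rewrite divr_ge0// ?ltW// addrC addKr.
have [xc|xc] := leP c x.
  have := bound (x - c); rewrite subrKC; apply; rewrite subr_ge0 xc/=.
  by rewrite (le_trans (ler_norm _)).
have := bound (c - x); rewrite -normrN -sign_poly_sym opprB subrKC; apply.
by rewrite subr_ge0 (ltW xc)/= (le_trans (ler_norm _))// distrC.
Qed.

Lemma sign_poly_cvg x : `|x - c| <= T ->
  (sign_poly n).[x] @[n --> \oo] --> Num.sg (x - c).
Proof.
move=> xT.
have pos y : 0 < y <= T -> (sign_poly n).[c + y] @[n --> \oo] --> (1 : R).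
  move=> /andP[y0 yT].
  have cy : c < c + y <= c + T by rewrite ltrDl y0 lerD2l.
  have yT0 : 0 < (c + y - c) / T by rewrite divr_gt0// addrC addKr.
  have yT1 : (c + y - c) / T <= 1 by rewrite ler_pdivrMr// addrC addKr mul1r.
  apply: (@squeeze_cvgr _ _ _ _ (fun n => 1 - (1 - (c + y - c) / T / 2) ^+ n)
     (fun=> 1)).
  - near=> n; have [/andP[_ ->] h] := @sign_poly_gt0 n (c + y) cy.
    by rewrite andbT; lra.
  - rewrite -[X in _ --> X]subr0; apply: cvgB; first exact: cvg_cst.
    by apply: cvg_expr; rewrite ger0_norm; lra.
  - exact: cvg_cst.
have [xc|xc|xc] := ltgtP c x.
- rewrite gtr0_sg ?subr_gt0// -(subrKC c x); apply: pos.
  by rewrite subr_gt0 xc (le_trans (ler_norm _)).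
- rewrite ltr0_sg ?subr_lt0//.
  have -> : (fun n => (sign_poly n).[x]) = (fun n => - (sign_poly n).[c + (c - x)]).
    by apply/funext => n; rewrite -sign_poly_sym subKr.
  apply: cvgN; apply: pos.
  by rewrite subr_gt0 xc (le_trans (ler_norm _))// distrC.
- rewrite -xc subrr sgr0; suff h n : (sign_poly n).[c] = 0.
    by under eq_cvg do rewrite h; exact: cvg_cst.
  elim: n => [|n IH]; first by rewrite horner_sign_poly0 subrr mul0r.
  by rewrite horner_sign_polyS IH; ring.
Unshelve. all: by end_near.
Qed.

(** The map y |-> (y + y^2) / 2 sends -1, 0, 1 to 0, 0, 1, so the limit is the indicator of the open
    half-line, with value 0 at [c] itself. *)
Definition step_poly n : {poly R} := 2^-1 *: (sign_poly n + sign_poly n ^+ 2).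

Lemma step_poly_bound n x : `|x - c| <= T -> `|(step_poly n).[x]| <= 1.
Proof.
move=> /(@sign_poly_bound n x); rewrite /step_poly hornerZ hornerD horner_exp.
rewrite !ler_norml => /andP[h1 h2]; apply/andP; split; nra.
Qed.

Lemma step_poly_cvg x : `|x - c| <= T ->
  (step_poly n).[x] @[n --> \oo] --> ((c < x)%R%:R : R).
Proof.
move=> xT; have sc := sign_poly_cvg xT.
have -> : (c < x)%R%:R = 2^-1 * (Num.sg (x - c) + Num.sg (x - c) * Num.sg (x - c)) :> R.
  rewrite -subr_gt0; case: sgrP => h; rewrite ?h ?ltxx//=; by field.
have -> : (fun n => (step_poly n).[x]) =
    (fun n => 2^-1 * ((sign_poly n).[x] + (sign_poly n).[x] * (sign_poly n).[x])).
  by apply/funext => n; rewrite /step_poly hornerZ hornerD expr2 hornerM.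
apply: cvgM; first exact: cvg_cst.
by apply: cvgD => //; exact: cvgM.
Qed.

End SignPolynomials.

(** * The absolutely continuous part *)

Section TruncatedInverse.
Context {R : realType}.
Variables (D : {poly R}) (B : R).

(* By horner_inv_poly, this sequence tends to 1/D wherever 0 < D^2 <= B. *)
Fixpoint inv_poly n : {poly R} :=
  if n is k.+1 then inv_poly k * (1%:P - B^-1 *: D ^+ 2) + B^-1 *: D else 0.

Lemma horner_inv_poly n x :
  D.[x] * (inv_poly n).[x] = 1 - (1 - D.[x] ^+ 2 / B) ^+ n.
Proof.
elim: n => [|n IH]; first by rewrite horner0 mulr0 expr0 subrr.
rewrite /= hornerD hornerM hornerD hornerN !hornerZ horner_exp hornerC.
transitivity (D.[x] * (inv_poly n).[x] * (1 - B^-1 * D.[x] ^+ 2) + B^-1 * D.[x] ^+ 2).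
  by ring.
by rewrite IH [_ ^+ n.+1]exprSr; ring.
Qed.

End TruncatedInverse.

Section Spectral.
Context {R : realType}.
Variables (q b : R) (L : probability (measurableTypeR R) R).
Hypotheses (b_gt0 : 0 < b) (q_gtN1 : -1 < q) (q_le1 : q <= 1).
Hypothesis L_pow : forall n : nat,
  L.-integrable setT (EFin \o (fun x : measurableTypeR R => x ^+ n)).
Local Notation P := (opoly (@jacobi_weight R q b)).
Local Notation Dp := (denom_poly q b).
Notation mu := (@lebesgue_measure R).

Definition expect (p : {poly R}) : R := \int[L]_x p.[x].

Hypothesis expectP : forall n, expect (P n) = (n == 0%N)%:R.

Let L_pow1 n :
  L.-integrable setT (EFin \o (fun x : measurableTypeR R => x ^+ n * cst (1 : R) x)).
Proof. by apply: eq_integrable (L_pow n) => // x _ /=; rewrite mulr1. Qed.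

Lemma integrable_poly (p : {poly R}) :
  L.-integrable setT (EFin \o (fun x : measurableTypeR R => p.[x])).
Proof.
have := integrable_horner measurableT L_pow1 p.
by apply: eq_integrable => // x _ /=; rewrite mulr1.
Qed.

Lemma expect_scalar : scalar expect.
Proof.
move=> c p r; have := poly_integral_scalar measurableT L_pow1 c p r.
rewrite /poly_integral /expect.
suff e p' : \int[L]_x (p'.[x] * cst (1 : R) x) = \int[L]_x p'.[x] by rewrite !e.
by apply: eq_Rintegral => x _; rewrite mulr1.
Qed.

Lemma EFin_expect p : (expect p)%:E = (\int[L]_x (p.[x])%:E)%E.
Proof.
rewrite /expect /Rintegral fineK//.
by apply: integrable_fin_num => //; exact: integrable_poly.
Qed.

Lemma markov_poly (p : {poly R}) (S : set (measurableTypeR R)) c :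
  measurable S -> 0 <= c -> (forall x, 0 <= p.[x]) ->
  (forall x, S x -> c <= p.[x]) -> (c%:E * L S <= (expect p)%:E)%E.
Proof.
move=> mS c0 p0 pc; rewrite -integral_cst// EFin_expect.
have mp : measurable_fun setT (fun x : measurableTypeR R => (p.[x])%:E).
  exact: measurable_int (integrable_poly p).
apply: (@le_trans _ _ (\int[L]_(x in S) (p.[x])%:E)%E); last first.
  by apply: ge0_subset_integral => // x _; rewrite lee_fin.
by apply: ge0_le_integral => //; exact: measurable_funS mp.
Qed.

(** All weights are at most 2 b, so the moment of order m is at most (1 + 2 b)^m; any T > 1 + 2 b
    then bounds the support, by the Markov inequality for x^(2n). *)
Let T : R := 2 + 2 * b.

Lemma jacobi_weight_le k : `|@jacobi_weight R q b k| <= 2 * b.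
Proof.
have h1 : 0 <= b by exact: ltW.
have h2 : b <= 2 * b by lra.
have h3 : 0 <= (1 + q) * b by have := q_gtN1; nra.
have h4 : (1 + q) * b <= 2 * b by have := q_le1; nra.
by case: k => [|[|k]] /=; rewrite ger0_norm.
Qed.

Let measurable_outside : measurable [set x : measurableTypeR R | T <= `|x|].
Proof.
rewrite (_ : [set x | _] = ~` `](- T), T[%classic).
  by apply: measurableC; exact: measurable_itv.
by apply/seteqP; split => x /=; rewrite in_itv/= leNgt ltr_norml => /negP.
Qed.

Lemma vacuum_support : L [set x : measurableTypeR R | T <= `|x|] = 0%E.
Proof.
have T0 : 0 < T by rewrite addr_gt0// mulr_gt0.
have mS := measurable_outside.
have fS : L [set x : measurableTypeR R | T <= `|x|] \is a fin_num.
  exact: fin_num_measure.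
rewrite -(fineK fS); congr EFin; apply/eqP; rewrite eq_le fine_ge0// andbT.
set r := (1 + 2 * b) ^+ 2 / T ^+ 2.
have r0 : 0 <= r by rewrite divr_ge0 ?sqr_ge0.
have r1 : r < 1.
  rewrite ltr_pdivrMr ?exprn_gt0// mul1r ltr_pXn2r ?nnegrE ?ltW//.
    by rewrite ltrD2r ltr1n.
  by rewrite addr_gt0// mulr_gt0.
have rn : (fun n => r ^+ n) @ \oo --> (0 : R) by apply: cvg_expr; rewrite ger0_norm.
apply: (cvgr_to_ge rn); near=> n; rewrite exprMn exprVn -!exprM ler_pdivlMr ?exprn_gt0// mulrC.
rewrite -lee_fin EFinM fineK//.
apply: (@le_trans _ _ (expect ('X^(2 * n)))%:E).
  apply: markov_poly => //.
  - by rewrite exprn_ge0// ltW.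
  - by move=> x; rewrite hornerXn exprM exprn_ge0// sqr_ge0.
  - move=> x /= Tx; rewrite hornerXn !exprM.
    rewrite lerXn2r ?nnegrE ?sqr_ge0 ?exprn_ge0 ?(ltW T0)//.
    by rewrite -[leRHS]real_normK ?num_real// lerXn2r ?nnegrE ?(ltW T0).
rewrite lee_fin (le_trans (ler_norm _))//.
have := scalar_form_bound expect_scalar expectP (2 * n) 0 jacobi_weight_le.
by rewrite mulr1.
Unshelve. all: by end_near.
Qed.

Lemma vacuum_support_ae : {ae L, forall x : measurableTypeR R, `|x| <= T}.
Proof.
exists [set x : measurableTypeR R | T <= `|x|]; split => //.
  exact: vacuum_support.
by move=> x /= /negP; rewrite -ltNge => /ltW.
Qed.

Lemma expect_le1 p : (forall x, `|x| <= T -> `|p.[x]| <= 1) ->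
  ((expect p)%:E <= 1)%E.
Proof.
move=> p1; have ip := integrable_poly p; have mp := measurable_int _ ip.
rewrite EFin_expect (le_trans (lee_abs _))// (le_trans (le_abse_integral _ _ mp))//.
apply: (@le_trans _ _ (\int[L]_x cst 1 x)%E); last first.
  by rewrite integral_cst// mul1e; exact: probability_le1.
apply: ae_ge0_le_integral => //; first exact: measurableT_comp.
case: vacuum_support_ae => S [mS S0 TS]; exists S; split => // x /=.
move=> h; apply: TS => /= xT; apply: h => _ /=.
by rewrite lee_fin p1.
Qed.

Let N := Num.sqrt b.
Let I : set (measurableTypeR R) := `[- (2 * N), 2 * N]%classic.
Let w (x : R) := Num.sqrt (4 * b - x ^+ 2).
Let K : R := (1 + q) * b / (2 * pi).
Local Notation J := (poly_integral mu I w).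

(** Both sides are compared on the U_n. The constant is (1 + q) b^2, the value of E(D), divided by
    the integral 2 pi b of the weight. *)
Lemma expect_denom p : expect (Dp * p) = K * J p.
Proof.
apply: (@scalar_form_ext R (fun=> b) (fun p => expect (Dp * p)) _ (fun p => K * J p)).
- move=> c u v /=; rewrite mulrDr -scalerAr.
  exact: expect_scalar.
- move=> c u v /=.
  have -> : J (c *: u + v) = c * J u + J v.
    exact: (poly_integral_scalar (measurable_itv _) (semicircle_integrable b)).
  by ring.
move=> n; rewrite (scalar_form_denom_chebyshev _ expect_scalar expectP).
rewrite semicircle_chebyshev// /K.
by move: pi (lt0r_neq0 (pi_gt0 R)) => y y0; field.
Qed.


Let NE : N ^+ 2 = b. Proof. by rewrite sqr_sqrtr// ltW. Qed.
Let N_gt0 : 0 < N. Proof. by rewrite sqrtr_gt0. Qed.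

Let K_gt0 : 0 < K.
Proof.
by rewrite divr_gt0// mulr_gt0 ?pi_gt0//; have := q_gtN1; lra.
Qed.

Definition spectral_density (x : R) : R :=
  (1 + q) * b / (2 * pi) * (Num.sqrt (4 * b - x ^+ 2) / Dp.[x]) *
  \1_(`](- (2 * Num.sqrt b)), (2 * Num.sqrt b)[) x.
Local Notation l := spectral_density.

Lemma denom_interior_gt0 x : - (2 * N) < x < 2 * N -> 0 < Dp.[x].
Proof.
move=> /andP[x1 x2]; apply: denom_poly_gt0 => //; first by rewrite q_gtN1.
by right; rewrite -NE; nra.
Qed.

Lemma spectral_densityE x : - (2 * N) < x < 2 * N -> l x = K * (w x / Dp.[x]).
Proof.
by move=> xN; rewrite /l indicE mem_set/= ?mulr1// in_itv.
Qed.

Lemma spectral_density0 x : ~~ (- (2 * N) < x < 2 * N) -> l x = 0.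
Proof.
by move=> /negP xN; rewrite /l indicE memNset/= ?mulr0//= in_itv.
Qed.

Lemma spectral_density_ge0 x : 0 <= l x.
Proof.
have [xN|xN] := boolP (- (2 * N) < x < 2 * N); last by rewrite spectral_density0.
rewrite spectral_densityE//; apply: mulr_ge0; first exact: ltW.
apply: divr_ge0; first exact: sqrtr_ge0.
exact/ltW/denom_interior_gt0.
Qed.

Lemma measurable_horner (p : {poly R}) :
  measurable_fun [set: measurableTypeR R] (fun x : measurableTypeR R => p.[x]).
Proof. by apply: continuous_measurable_fun; exact: continuous_horner. Qed.

Lemma measurable_spectral_density :
  measurable_fun [set: measurableTypeR R] spectral_density.
Proof.
have -> : spectral_density = (fun x => K * (w x / Dp.[x])) \_ `](- (2 * N)), (2 * N)[.
  apply/funext => x; rewrite patchE; case: ifPn; rewrite ?inE/= ?notin_setE/= in_itv/=.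
    exact: spectral_densityE.
  by move=> /negP; exact: spectral_density0.
apply/(measurable_restrictT _ _).1; first exact: measurable_itv.
apply: open_continuous_measurable_fun; first exact: itv_open.
move=> x; rewrite inE/= in_itv/= => /denom_interior_gt0 D0.
apply: cvgM; first exact: cvg_cst.
apply: cvgM; first exact: continuous_semicircle.
by apply: cvgV; [exact: lt0r_neq0|exact: continuous_horner].
Qed.

Let M : R := (b ^+ 2 + `|q * (q + 3) * b| * T ^+ 2 + `|q| * T ^+ 4) ^+ 2 + 1.

Let M_gt0 : 0 < M. Proof. by rewrite ltr_wpDl ?sqr_ge0. Qed.

Let T_gt0 : 0 < T. Proof. by rewrite addr_gt0// mulr_gt0. Qed.

Let denom_sqr_le (x : R) : `|x| <= T -> Dp.[x] ^+ 2 <= M.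
Proof.
move=> xT; rewrite (@le_trans _ _ ((b ^+ 2 + `|q * (q + 3) * b| * T ^+ 2 +
  `|q| * T ^+ 4) ^+ 2)) ?lerDl//.
rewrite -real_normK ?num_real// lerXn2r ?nnegrE//.
  by rewrite !addr_ge0 ?sqr_ge0 ?mulr_ge0 ?exprn_ge0 ?(ltW T_gt0).
rewrite horner_denom_poly (le_trans (ler_normB _ _))// lerD//.
  rewrite (le_trans (ler_normD _ _))// lerD//.
    by rewrite ger0_norm ?sqr_ge0.
  by rewrite normrM ler_wpM2l// normrX lerXn2r ?nnegrE ?(ltW T_gt0).
by rewrite normrM ler_wpM2l// normrX lerXn2r ?nnegrE ?(ltW T_gt0).
Qed.

(** The value of D times [inv_poly]. On [-T, T] it lies in [0, 1], increases with n and tends to the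
    indicator of D <> 0; this is how the zeros of D drop out. *)
Let damp n (x : R) : R := 1 - (1 - Dp.[x] ^+ 2 / M) ^+ n.

Let damp_base x : `|x| <= T -> 0 <= 1 - Dp.[x] ^+ 2 / M <= 1.
Proof.
move=> /denom_sqr_le xM; rewrite subr_ge0 ler_pdivrMr// mul1r xM/=.
by rewrite gerBl divr_ge0 ?sqr_ge0// ltW.
Qed.

Let damp_bound n x : `|x| <= T -> 0 <= damp n x <= 1.
Proof.
move=> /damp_base /andP[h1 h2]; rewrite /damp subr_ge0 exprn_ile1//=.
by rewrite gerBl exprn_ge0.
Qed.

Let damp_nd x : `|x| <= T -> {homo damp ^~ x : m n / (m <= n)%N >-> m <= n}.
Proof.
move=> /damp_base /andP[h1 h2] m n mn; rewrite /damp lerB//.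
exact: ler_wiXn2l.
Qed.

Let damp_cvg x : `|x| <= T -> damp n x @[n --> \oo] --> ((Dp.[x] != 0)%:R : R).
Proof.
move=> xT; have [D0|D0] := eqVneq Dp.[x] 0.
  have -> : (damp ^~ x) = cst 0 by
    apply/funext => n; rewrite /damp D0 expr0n mul0r subr0 expr1n subrr.
  exact: cvg_cst.
rewrite /= -[X in _ --> X]subr0; apply: cvgB; first exact: cvg_cst.
apply: cvg_expr; have /andP[h1 h2] := damp_base xT.
rewrite ger0_norm// gtrBl divr_gt0//.
by rewrite lt_def sqrf_eq0 D0 sqr_ge0.
Qed.

Let inv n := inv_poly Dp M n.

Let N2T : 2 * N <= T.
Proof. by rewrite /T -NE; have := sqr_ge0 (N - 1); nra. Qed.

Let IT x : I x -> `|x| <= T.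
Proof.
by rewrite /I/= in_itv/= -ler_norml => /le_trans; exact.
Qed.

Let expect_trunc n p : (expect (Dp * (inv n * p)))%:E =
  (\int[mu]_(x in I) (damp n x * p.[x] * l x)%:E)%E.
Proof.
have intI r : mu.-integrable I (EFin \o (fun x : measurableTypeR R => r.[x] * w x)).
  exact: (integrable_horner (measurable_itv _) (semicircle_integrable b)).
rewrite expect_denom EFinM /poly_integral /Rintegral fineK; last first.
  apply: integrable_fin_num; first exact: measurable_itv.
  exact: intI.
rewrite -integralZl; [|exact: measurable_itv|exact: intI].
apply: eq_integral => x; rewrite inE /I/= in_itv/= => xI.
rewrite -EFinM; congr EFin; rewrite hornerM.
have [xN|xN] := boolP (- (2 * N) < x < 2 * N).
  have D0 := lt0r_neq0 (denom_interior_gt0 xN).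
  by rewrite spectral_densityE// /damp -horner_inv_poly -/(inv n); field.
(* The integral is over the closed interval and the density lives on the open one: at the ends both
   integrands are 0. *)
rewrite spectral_density0// mulr0.
suff -> : w x = 0 by rewrite !mulr0.
apply/eqP; rewrite sqrtr_eq0 -NE.
by move: xN; rewrite negb_and -!leNgt => /orP[]; nra.
Qed.

Let mI : measurable I. Proof. exact: measurable_itv. Qed.

Let measurable_damp n : measurable_fun [set: measurableTypeR R] (damp n).
Proof.
rewrite (_ : damp n = fun x => (Dp * inv n).[x]); first exact: measurable_horner.
by apply/funext => x; rewrite hornerM horner_inv_poly.
Qed.

(** For q = 1/2 the density is unbounded, so its integrability is deduced from [L]: by monotone
    convergence its integral is the limit of E(D inv_n), where D inv_n <= 1 on the support. The
    density can then dominate. *)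
Lemma integral_spectral_density_le1 :
  (\int[mu]_(x in I) (l x)%:E <= 1)%E.
Proof.
have ml : measurable_fun I (EFin \o l).
  by apply/measurable_EFinP; apply: measurable_funTS; exact: measurable_spectral_density.
have mdl n : measurable_fun I (fun x : measurableTypeR R => (damp n x * l x)%:E).
  apply/measurable_EFinP; apply: measurable_funTS; apply: measurable_funM => //.
  exact: measurable_spectral_density.
have : (\int[mu]_(x in I) (damp n x * l x)%:E)%E @[n --> \oo] -->
    (\int[mu]_(x in I) limn (fun n => (damp n x * l x)%:E))%E.
  apply: cvg_monotone_convergence => //.
  - move=> n x Ix; rewrite lee_fin mulr_ge0 ?spectral_density_ge0//.
    by have /andP[] := damp_bound n (IT Ix).
  - move=> x Ix m n mn; rewrite lee_fin ler_wpM2r ?spectral_density_ge0//.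
    exact: (damp_nd (IT Ix)).
have -> : (\int[mu]_(x in I) limn (fun n => (damp n x * l x)%:E) =
    \int[mu]_(x in I) (l x)%:E)%E.
  apply: eq_integral => x; rewrite inE => Ix; apply/cvg_lim => //.
  apply: cvg_EFin; first exact: nearW.
  have [xN|xN] := boolP (- (2 * N) < x < 2 * N); last first.
    rewrite spectral_density0//.
    rewrite (_ : _ \o _ = cst 0); first exact: cvg_cst.
    by apply/funext => n /=; rewrite mulr0.
  rewrite -[X in _ --> X]mul1r; apply: cvgM; last exact: cvg_cst.
  have := damp_cvg (IT Ix).
  by rewrite lt0r_neq0// denom_interior_gt0.
move=> /cvge_to_le; apply; apply: nearW => n.
have -> : (\int[mu]_(x in I) (damp n x * l x)%:E = (expect (Dp * inv n))%:E)%E.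
  rewrite -[inv n]mulr1 expect_trunc; apply: eq_integral => x _.
  by rewrite hornerC mulr1.
apply: expect_le1 => x xT; rewrite hornerM horner_inv_poly -/(damp n x).
by have /andP[d0 d1] := damp_bound n xT; rewrite ger0_norm.
Qed.

Let mI_l : measurable_fun I (EFin \o l).
Proof.
by apply/measurable_EFinP; apply: measurable_funTS; exact: measurable_spectral_density.
Qed.

Let integrable_l : mu.-integrable I (EFin \o l).
Proof.
apply/integrableP; split => //.
rewrite (_ : (\int[mu]_(x in I) `|(EFin \o l) x|)%E = (\int[mu]_(x in I) (l x)%:E)%E).
  exact: le_lt_trans integral_spectral_density_le1 (ltry _).
by apply: eq_integral => x _ /=; rewrite ger0_norm// spectral_density_ge0.
Qed.

Let mnz : measurable [set x : measurableTypeR R | Dp.[x] != 0].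
Proof.
rewrite (_ : [set x | _] = (fun x : measurableTypeR R => Dp.[x]) @^-1` [set~ 0]).
  by rewrite -[X in measurable X]setTI; apply: measurable_horner => //; exact: measurableC.
by apply/seteqP; split => x /= /eqP.
Qed.

(** The limit of E(D inv_n st_n) is computed twice: under [L], dominated by 1, and, by
    [expect_trunc], under Lebesgue measure, dominated by the density. *)
Lemma vacuum_tail c :
  L (`]c, +oo[ `&` [set x : measurableTypeR R | Dp.[x] != 0]) =
  (\int[mu]_(x in `]c, +oo[) (l x)%:E)%E.
Proof.
pose Tc := T + `|c|.
have Tc_gt0 : 0 < Tc by rewrite ltr_pwDl.
have xc x : `|x| <= T -> `|x - c| <= Tc.
  by move=> xT; rewrite (le_trans (ler_normB _ _))// lerD2r.
pose st n := step_poly c Tc n.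
have mst n : measurable_fun [set: measurableTypeR R] (fun x : measurableTypeR R => (st n).[x]).
  exact: measurable_horner.
have mray : measurable (`]c, +oo[%classic : set (measurableTypeR R)).
  exact: measurable_itv.
have cvgL : (expect (Dp * (inv n * st n)))%:E @[n --> \oo] -->
    L (`]c, +oo[ `&` [set x : measurableTypeR R | Dp.[x] != 0]).
  have mA : measurable (`]c, +oo[ `&` [set x : measurableTypeR R | Dp.[x] != 0]).
    exact: measurableI.
  have -> : L (`]c, +oo[ `&` [set x : measurableTypeR R | Dp.[x] != 0]) =
      (\int[L]_x (\1_(`]c, +oo[ `&` [set x : measurableTypeR R | Dp.[x] != 0]) x)%:E)%E.
    by rewrite integral_indic// setIT.
  under eq_fun do rewrite EFin_expect.
  have [N0 [mN0 LN0 TN0]] := vacuum_support_ae.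
  have pE n x : (Dp * (inv n * st n)).[x] = damp n x * (st n).[x].
    by rewrite !hornerM mulrA /damp -horner_inv_poly.
  have [] // := @dominated_convergence _ _ _ L setT measurableT
    (fun n x => (Dp * (inv n * st n)).[x]%:E)
    (fun x => (\1_(`]c, +oo[ `&` [set x : measurableTypeR R | Dp.[x] != 0]) x)%:E)
    (cst 1%E).
  - by move=> n; apply/measurable_EFinP; exact: measurable_horner.
  - by apply/measurable_EFinP; exact: measurable_indic.
  - exists N0; split => // x /= h; apply: TN0 => /= xT; apply: h => _.
    apply: cvg_EFin; first exact: nearW.
    have -> : fine \o (fun n => (Dp * (inv n * st n)).[x]%:E) =
       (fun n => damp n x * (st n).[x]) by apply/funext => n /=; rewrite pE.
    have -> : \1_(`]c, +oo[ `&` [set x | Dp.[x] != 0]) x = (Dp.[x] != 0)%:R * (c < x)%R%:R :> R.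
      by rewrite indicE in_setI !mem_setE in_itv/= andbT andbC -natrM mulnb.
    apply: cvgM; first exact: damp_cvg.
    exact/step_poly_cvg/xc.
  - exact: finite_measure_integrable_cst.
  - exists N0; split => // x /= h; apply: TN0 => /= xT; apply: h => n _.
    rewrite lee_fin pE normrM.
    have /andP[d0 d1] := damp_bound n xT.
    rewrite [X in X * _]ger0_norm// mulr_ile1//; exact: (step_poly_bound Tc_gt0 n (xc x xT)).
have cvgI : (expect (Dp * (inv n * st n)))%:E @[n --> \oo] -->
    (\int[mu]_(x in `]c, +oo[) (l x)%:E)%E.
  have -> : (\int[mu]_(x in `]c, +oo[) (l x)%:E)%E =
     (\int[mu]_(x in I) ((c < x)%R%:R * l x)%:E)%E.
    rewrite integral_mkcond [RHS]integral_mkcond; apply: eq_integral => x _.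
    rewrite !patchE !mem_setE !in_itv/= andbT.
    case: ifPn => cx; case: ifPn => xI; rewrite ?mul1r ?mul0r//.
    rewrite spectral_density0//; apply: contra xI => /andP[h1 h2].
    by rewrite !ltW.
  under eq_fun do rewrite expect_trunc.
  have [] // := @dominated_convergence _ _ _ mu I mI
    (fun n x => (damp n x * (st n).[x] * l x)%:E)
    (fun x => ((c < x)%R%:R * l x)%:E) (EFin \o l).
  - move=> n; apply/measurable_EFinP; apply: measurable_funTS.
    apply: measurable_funM; last exact: measurable_spectral_density.
    exact: measurable_funM.
  - apply/measurable_EFinP; apply: measurable_funTS.
    apply: measurable_funM => //; last exact: measurable_spectral_density.
    rewrite (_ : (fun x => _) = \1_(`]c, +oo[)); first exact: measurable_indic.
    by apply/funext => x; rewrite indicE mem_setE in_itv/= andbT.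
  - apply: aeW => x Ix.
    apply: cvg_EFin; first exact: nearW.
    have [xN|xN] := boolP (- (2 * N) < x < 2 * N); last first.
      rewrite spectral_density0// mulr0.
      rewrite (_ : _ \o _ = cst 0); first exact: cvg_cst.
      by apply/funext => n /=; rewrite mulr0.
    apply: cvgM; last exact: cvg_cst.
    rewrite -[X in _ --> X]mul1r; apply: cvgM; last exact/step_poly_cvg/xc/IT.
    have := damp_cvg (IT Ix).
    by rewrite lt0r_neq0// denom_interior_gt0.
  - apply: aeW => x n Ix.
    rewrite lee_fin normrM [X in _ * X]ger0_norm ?spectral_density_ge0//.
    rewrite ler_piMl ?spectral_density_ge0// normrM.
    have /andP[d0 d1] := damp_bound n (IT Ix).
    rewrite [X in X * _]ger0_norm// mulr_ile1//; exact: (step_poly_bound Tc_gt0 n (xc x (IT Ix))).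
exact: (cvg_unique _ cvgL cvgI).
Qed.

Lemma vacuum_regular_part (B : set (measurableTypeR R)) : measurable B ->
  L (B `&` [set x : measurableTypeR R | Dp.[x] != 0]) =
  (\int[mu]_(x in B) (l x)%:E)%E.
Proof.
move=> mB.
apply: (measure_eq_density measurable_spectral_density spectral_density_ge0
  (m := mrestr L mnz)) => //.
- rewrite /mrestr/=; apply: le_lt_trans (ltry 1).
  by apply: probability_le1; rewrite setTI.
- exact: vacuum_tail.
Qed.

End Spectral.

(** * The atoms *)

Section Atoms.
Context {R : realType}.
Variables (q b : R) (L : probability (measurableTypeR R) R).
Hypotheses (b_gt0 : 0 < b) (q_gt0 : 0 < q) (q_le1 : q <= 1).
Hypothesis L_pow : forall n : nat,
  L.-integrable setT (EFin \o (fun x : measurableTypeR R => x ^+ n)).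
Local Notation P := (opoly (@jacobi_weight R q b)).
Local Notation Dp := (denom_poly q b).
Notation mu := (@lebesgue_measure R).
Hypothesis expectP : forall n, expect L (P n) = (n == 0%N)%:R.
Variable c : R.
Hypothesis c_sqr : c ^+ 2 = b * (4 * a1 q).

Let z := decay_ratio q.
Let z_gt0 : 0 < z. Proof. exact: decay_ratio_gt0. Qed.
Let zE : q * z * (z + 1) = 1. Proof. exact: decay_ratioE. Qed.
Let c_sqrz : c ^+ 2 = b * (z + 1) ^+ 2 / z.
Proof. by rewrite c_sqr a1E// -/z; field; exact: lt0r_neq0. Qed.

Let q_gtN1 : -1 < q. Proof. exact: lt_trans q_gt0. Qed.

Let om_gt0 n : 0 < @jacobi_weight R q b n.
Proof. by case: n => [|[|n]] //=; rewrite mulr_gt0// addr_gt0. Qed.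

Let expS := expect_scalar L_pow.

Local Notation Kn n := (opoly_kernel (@jacobi_weight R q b) c n).

Let fL1 : L [set c] \is a fin_num.
Proof. exact: fin_num_measure. Qed.

Let w := fine (L [set c]).

Let w_ge0 : 0 <= w. Proof. by rewrite fine_ge0. Qed.

Let kernel_ge1 n : 1 <= (Kn n.+1).[c].
Proof.
rewrite (kernel_root b_gt0 z_gt0 zE c_sqrz).
have h1 : 0 <= (z + 1) ^+ 2 / z.
  by apply: divr_ge0; [exact: sqr_ge0|exact: ltW].
have h2 : 0 <= \sum_(j < n) (1 + q) * (1 + z) ^+ 2 * z ^+ j.
  apply: sumr_ge0 => j _; apply: mulr_ge0; last by rewrite exprn_ge0// ltW.
  by apply: mulr_ge0; [rewrite addr_ge0// ltW|exact: sqr_ge0].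
lra.
Qed.

(** Markov for K_n^2 at the point [c] gives w K_n(c)^2 <= E(K_n^2) = K_n(c). *)
Let atom_le n : w * (Kn n.+1).[c] <= 1.
Proof.
have K1 := kernel_ge1 n; have K0 : 0 < (Kn n.+1).[c] by exact: lt_le_trans K1.
have : (((Kn n.+1).[c] ^+ 2)%:E * L [set c] <= (expect L (Kn n.+1 ^+ 2))%:E)%E.
  apply: (markov_poly L_pow) => //.
  - exact: sqr_ge0.
  - by move=> x; rewrite horner_exp sqr_ge0.
  - by move=> x ->; rewrite horner_exp.
rewrite (scalar_form_kernel_sqr expS expectP c om_gt0)// -(fineK fL1) -EFinM lee_fin.
by rewrite expr2 -mulrA ger_pMr// mulrC.
Qed.

Lemma atom_mass0 : q <= 1 / 2 -> L [set c] = 0%E.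
Proof.
move=> q12; rewrite -(fineK fL1) -/w; congr EFin.
have z1 : 1 <= z by rewrite leNgt decay_ratio_lt1// -leNgt.
apply/eqP; rewrite eq_le w_ge0 andbT leNgt; apply/negP => w0.
have [n wn] : exists n : nat, w^-1 < n%:R.
  by exists (Num.truncn w^-1).+1; exact: truncnS_gt.
have := atom_le n; rewrite leNgt => /negP; apply.
rewrite -ltr_pdivrMl// mulr1 (lt_le_trans wn)//.
exact: (kernel_root_ge b_gt0 z_gt0 zE c_sqrz).
Qed.

Let N := Num.sqrt b.
Let NE : N ^+ 2 = b. Proof. by rewrite sqr_sqrtr// ltW. Qed.
Let N_gt0 : 0 < N. Proof. by rewrite sqrtr_gt0. Qed.

Let eps := `|c| - 2 * N.

Let atom_outside : z != 1 -> 0 < eps.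
Proof.
move=> z1; rewrite subr_gt0 -(@ltr_pXn2r _ 2) ?nnegrE ?mulr_ge0 ?(ltW N_gt0)//.
rewrite real_normK ?num_real// c_sqrz exprMn NE ltr_pdivlMr// -subr_gt0.
have -> : b * (z + 1) ^+ 2 - 2 ^+ 2 * b * z = b * (z - 1) ^+ 2 by ring.
by rewrite mulr_gt0// lt_def sqrf_eq0 subr_eq0 z1 sqr_ge0.
Qed.

(** [eps] is the distance from [c] to the interval that carries the density. Closer to [c] than that
    the density vanishes, and so does [L] off the zeros of D; the only other zero, -c, is at
    distance 2 |c| > eps. *)
Let atom_isolated : z != 1 ->
  {ae L, forall x : measurableTypeR R, x <> c -> eps <= `|x - c|}.
Proof.
move=> /atom_outside eps0.
pose S : set (measurableTypeR R) := `](c - eps), (c + eps)[ `\` [set c].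
have mS : measurable S.
  by apply: measurableD => //; exact: measurable_itv.
have SE (x : R) : S x <-> x <> c /\ `|x - c| < eps.
  by rewrite /S /= in_itv/= ltr_distl; split=> [[]|[]] //.
have SN (x : R) : S x -> 2 * N < `|x|.
  move=> /SE[_ xc]; have := ler_normB x (x - c); rewrite subKr.
  by move: xc; rewrite /eps; lra.
have SD : S `<=` [set x : measurableTypeR R | Dp.[x] != 0].
  move=> x Sx /=; apply/eqP => /(denom_poly_eq0 b_gt0 q_gt0) xE.
  have /SE[xc xe] := Sx.
  move: xE; rewrite -c_sqr => /eqP; rewrite eqf_sqr => /orP[/eqP//|/eqP xcN].
  move: xe; rewrite xcN -opprD normrN -mulr2n normrMn -mulr_natl /eps.
  by have := N_gt0; have := normr_ge0 c; lra.
exists S; split => //.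
  rewrite -(setIidl SD) (vacuum_regular_part b_gt0 q_gtN1 q_le1 L_pow expectP mS).
  apply: integral0_eq => x Sx; rewrite spectral_density0//.
  rewrite -ltr_norml -leNgt; exact/ltW/SN.
move=> x /= /not_implyP[xc /negP]; rewrite -ltNge => xe.
by apply/SE.
Qed.

(** E(K_n^2) = K_n(c) is split at the point [c]; elsewhere 1 <= (x - c)^2 / eps^2 almost
    everywhere. *)
Let atom_ge n : z != 1 ->
  (Kn n).[c] <= w * (Kn n).[c] ^+ 2 +
    eps ^- 2 * expect L ((('X - c%:P) * Kn n) ^+ 2).
Proof.
move=> z1; have eps0 := atom_outside z1.
set r := ('X - c%:P) * Kn n.
have m1 : measurable [set c] by exact: measurable_set1.
have mp (p : {poly R}) (S : set (measurableTypeR R)) :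
    measurable_fun S (fun x : measurableTypeR R => (p.[x])%:E).
  by apply/measurable_EFinP; apply: measurable_funTS; exact: measurable_horner.
have sq0 (p : {poly R}) x : (0 <= ((p ^+ 2).[x])%:E)%E.
  by rewrite lee_fin horner_exp sqr_ge0.
rewrite -lee_fin -{1}(scalar_form_kernel_sqr expS expectP c om_gt0).
rewrite (EFin_expect L_pow) -(setUv [set c]) ge0_integral_setU//; last 2 first.
- exact: measurableC.
- exact/disj_setPCl.
rewrite EFinD leeD//.
  have -> : (w * (Kn n).[c] ^+ 2)%:E = (((Kn n).[c] ^+ 2)%:E * L [set c])%E.
    by rewrite -(fineK fL1) -EFinM mulrC.
  rewrite -integral_cst//; apply: ge0_le_integral => //.
  by move=> x ->; rewrite horner_exp.
rewrite -(scalar_formZ expS) (EFin_expect L_pow).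
apply: (@le_trans _ _ (\int[L]_(x in ~` [set c]) ((eps ^- 2 *: r ^+ 2).[x])%:E)%E); last first.
  apply: ge0_subset_integral => //; first exact: measurableC.
  by move=> x _; rewrite lee_fin hornerZ horner_exp mulr_ge0 ?invr_ge0 ?sqr_ge0.
apply: ae_ge0_le_integral => //; first exact: measurableC.
  by move=> x _; rewrite lee_fin hornerZ horner_exp mulr_ge0 ?invr_ge0 ?sqr_ge0.
have [S [mS S0 SS]] := atom_isolated z1; exists S; split => // x /= h.
apply: SS => /= xc; apply: h => cx.
rewrite lee_fin hornerZ /r !horner_exp hornerM hornerXsubC exprMn.
rewrite mulrA ler_peMl ?sqr_ge0// mulrC ler_pdivlMr ?exprn_gt0// mul1r.
rewrite -[leRHS]real_normK ?num_real// lerXn2r ?nnegrE ?(ltW eps0)//.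
exact: xc.
Qed.

Lemma atom_mass : 1 / 2 < q ->
  L [set c] = (1 / 2 * (1 - (1 + q) / Num.sqrt (q * (q + 4))))%:E.
Proof.
move=> q12; have z_lt1 : z < 1 by rewrite decay_ratio_lt1.
have z1 : z != 1 by rewrite lt_eqF.
rewrite -(fineK fL1) -/w; congr EFin.
rewrite atom_weightE// -/z.
have Kc := kernel_root_cvg b_gt0 z_gt0 zE c_sqrz z_lt1.
set k := (4 * z + 2) / (z * (1 - z)) in Kc.
have k_gt0 : 0 < k.
  apply: divr_gt0; first by apply: addr_gt0 => //; exact: mulr_gt0.
  by apply: mulr_gt0 => //; rewrite subr_gt0.
have wk_le1 : w * k <= 1.
  apply: (cvgr_to_le (cvgM (cvg_cst w) Kc)).
  by apply: nearW => n; exact: atom_le.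
(* The remainder in [atom_ge] tends to 0 by the Christoffel-Darboux formula, which leaves the
   inequality opposite to [wk_le1]. *)
have k_le : k <= w * k ^+ 2.
  have CD := christoffel_darboux_root_cvg b_gt0 z_gt0 zE c_sqrz z_lt1.
  rewrite -cvg_shiftS in CD.
  have rhs : (fun n => w * ((Kn n.+1).[c] * (Kn n.+1).[c]) +
      eps ^- 2 * (((P n.+1).[c] ^+ 2 * opoly_norm (@jacobi_weight R q b) n.+2 +
       (P n.+2).[c] ^+ 2 * opoly_norm (@jacobi_weight R q b) n.+1) /
       opoly_norm (@jacobi_weight R q b) n.+1 ^+ 2)) @ \oo --> w * (k * k).
    rewrite -[X in _ --> X]addr0 -[X in _ --> _ + X](mulr0 (eps ^- 2)).
    apply: cvgD; apply: cvgM; [exact: cvg_cst|exact: cvgM|exact: cvg_cst|].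
    exact: CD.
  rewrite expr2; apply: (ler_cvg_to Kc rhs); apply: nearW => n.
  have := atom_ge n.+1 z1.
  by rewrite (scalar_form_christoffel_darboux expS expectP c om_gt0) expr2.
have wk : w * k = 1.
  apply/eqP; rewrite eq_le wk_le1/=.
  by move: k_le; rewrite expr2 mulrA -{1}[k]mul1r ler_pM2r.
rewrite -[w](mulfK (lt0r_neq0 k_gt0)) wk mul1r /k invf_div.
by [].
Qed.

End Atoms.

(** * The vacuum distribution *)

Section VacuumMoments.
Context {R : realType} {q : R} {H : hilbertSpace R} (G : fockSpace q H).
Variables (f : H) (Ap : {linear G -> G}) (A : G -> G).
Hypotheses (Ap_creation : is_creation f Ap) (A_adjoint : is_adjoint Ap A).
Variable L : probability (measurableTypeR R) R.
Hypothesis L_dist : is_vacuum_distribution (fun x : G => A x + Ap x) L.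
Local Notation P := (opoly (@jacobi_weight R q (hnorm f ^+ 2))).

Let L_pow (n : nat) :
  L.-integrable setT (EFin \o (fun x : measurableTypeR R => x ^+ n)).
Proof. by have [] := L_dist n. Qed.

Let vacuumE : vacuum G = fock_pow G f 0.
Proof. by congr fock_tens; exact: val_inj. Qed.

(** This is P_n(Q) vacuum = f^n, paired with Q^m vacuum. With m arbitrary, the factor X of the
    recurrence is absorbed into m + 1, and the statement involves only powers of the operator. *)
Lemma expect_pow_opoly n m :
  (expect L ('X^m * P n))%:C%C =
  inner (vacuum G) (iter m (field_op Ap A) (fock_pow G f n)).
Proof.
have lin := expect_scalar L_pow.
suff : (forall m, (expect L ('X^m * P n))%:C%C =
      inner (vacuum G) (iter m (field_op Ap A) (fock_pow G f n))) /\
    (forall m, (expect L ('X^m * P n.+1))%:C%C =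
      inner (vacuum G) (iter m (field_op Ap A) (fock_pow G f n.+1))) by case.
elim: n {m} => [|n [IH0 IH1]].
  have IH0 m : (expect L ('X^m * P 0))%:C%C =
      inner (vacuum G) (iter m (field_op Ap A) (fock_pow G f 0)).
    rewrite mulr1 -vacuumE; have [_ <-] := L_dist m.
    by congr (_%:C)%C; apply: eq_Rintegral => x _; rewrite hornerXn.
  split=> // m.
  by rewrite -exprSr -['X^_]mulr1 IH0 iterSr field_op_pow0.
split=> // m; rewrite opolySS mulrBr (scalar_formB lin) mulrA -exprSr.
rewrite -scalerAr (scalar_formZ lin).
have morph (u v w : R) : (u - v * w)%:C%C = u%:C%C - v%:C%C * w%:C%C :> R[i].
  by rewrite rmorphB rmorphM.
rewrite morph IH0 IH1 iterSr (field_op_powS Ap_creation A_adjoint).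
rewrite -innerZr -innerBr -(field_op_iterZ A_adjoint) -(field_op_iterB A_adjoint).
by rewrite addrK.
Qed.

Lemma expect_opoly n : expect L (P n) = (n == 0%N)%:R.
Proof.
have := expect_pow_opoly n 0; rewrite mul1r /= => e.
apply: (@complexI R); rewrite [LHS]e vacuumE.
case: n {e} => [|n].
  by rewrite inner_fock_tens_pow big_ord0 mulr1.
by rewrite inner_fock_tens_neq.
Qed.

End VacuumMoments.

Lemma l_densityE (R : realType) (q : R) (H : hilbertSpace R) (f : H) :
  l_density q f = spectral_density q (hnorm f ^+ 2).
Proof.
apply/funext => x; rewrite /l_density /spectral_density horner_denom_poly.
rewrite sqrtr_sqr ger0_norm; last by rewrite -ler0c -hnormE.
by rewrite -exprM.
Qed.

(** * Decomposition of the law into density and atoms *)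

Section VacuumLaw.
Context {R : realType}.
Variables (q b : R) (L : probability (measurableTypeR R) R).
Hypotheses (b_gt0 : 0 < b) (q_gtN1 : -1 < q) (q_le1 : q <= 1).
Hypothesis L_pow : forall n : nat,
  L.-integrable setT (EFin \o (fun x : measurableTypeR R => x ^+ n)).
Hypothesis expectP : forall n,
  expect L (opoly (@jacobi_weight R q b) n) = (n == 0%N)%:R.
Notation mu := (@lebesgue_measure R).
Local Notation l := (spectral_density q b).

Lemma vacuum_law_le0 (B : set (measurableTypeR R)) : q <= 0 -> measurable B ->
  L B = (\int[mu]_(x in B) (l x)%:E)%E.
Proof.
move=> q0 mB; rewrite -(vacuum_regular_part b_gt0 q_gtN1 q_le1 L_pow expectP mB).
congr (L _); rewrite setIidl// => x _ /=.
by rewrite lt0r_neq0// denom_poly_gt0 ?q_gtN1 ?q_le1//; left.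
Qed.

Lemma root_sqr : 0 < q ->
  (2 * Num.sqrt b * Num.sqrt (a1 q)) ^+ 2 = b * (4 * a1 q).
Proof.
by move=> q_gt0; rewrite !exprMn !sqr_sqrtr ?a1_ge0 ?(ltW b_gt0)//; ring.
Qed.

(** All zeros of D are among c and -c: off these two points [L] is the regular part, and for
    Lebesgue measure they are negligible. They are distinct since a1 > 0. *)
Lemma vacuum_law_gt0 (B : set (measurableTypeR R)) : 0 < q -> measurable B ->
  let c : R := 2 * Num.sqrt b * Num.sqrt (a1 q) in
  L B = (\int[mu]_(x in B) (l x)%:E +
    (L [set (- c)%R] * \d_(- c)%R B + L [set c] * \d_c B))%E.
Proof.
move=> q_gt0 mB c.
have a1_gt0 : 0 < a1 q.
  have z0 := decay_ratio_gt0 q_gt0; have zV0 : 0 < (decay_ratio q)^-1 by rewrite invr_gt0.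
  by have := a1E q_gt0; lra.
have c_gt0 : 0 < c by rewrite !mulr_gt0// sqrtr_gt0.
have c_sqr : c ^+ 2 = b * (4 * a1 q).
  exact: root_sqr.
pose S : set (measurableTypeR R) := [set - c] `|` [set c].
have mS : measurable S by apply: measurableU; exact: measurable_set1.
have mBS : measurable (B `\` S) by exact: measurableD.
have atom (x : R) : L (B `&` [set x]) = (L [set x] * \d_x B)%E.
  rewrite diracE; have [xB|xB] := boolP (x \in B).
    by rewrite mule1; congr (L _); rewrite setIidr// => _ ->; rewrite -inE.
  rewrite mule0 (_ : B `&` _ = set0) ?measure0//.
  by apply/seteqP; split=> // y [By yx]; move: xB; rewrite -yx mem_set.
have mBI : measurable (B `&` S) by exact: measurableI.
rewrite (measureDI _ mB mS).
congr (_ + _)%E.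
  have DS : B `\` S `<=` [set x : measurableTypeR R | (denom_poly q b).[x] != 0].
    move=> x [_ xS] /=; apply/eqP => /(denom_poly_eq0 b_gt0 q_gt0).
    by rewrite -c_sqr => /eqP; rewrite eqf_sqr => /orP[] /eqP xc; apply: xS; [right|left].
  have := vacuum_regular_part b_gt0 q_gtN1 q_le1 L_pow expectP mBS.
  rewrite (setIidl DS) => e; apply: (etrans e).
  rewrite -ge0_negligible_integral//.
  - by apply/measurable_EFinP; apply: measurable_funTS; exact: measurable_spectral_density.
  - by move=> x _; rewrite lee_fin spectral_density_ge0.
  - apply: null_set_setU; [exact: measurable_set1|exact: measurable_set1| |];
      exact: lebesgue_measure_set1.
rewrite setIUr measureU.
- by congr (_ + _)%E; exact: atom.
- by apply: measurableI => //; exact: measurable_set1.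
- by apply: measurableI => //; exact: measurable_set1.
apply/seteqP; split=> // x [[_ /= ->] [_ /= cc]].
by have /eqP := cc; rewrite eq_sym -subr_eq0 opprK -mulr2n mulrn_eq0/= gt_eqF.
Qed.

End VacuumLaw.

Theorem theorem3p9 (R : realType) (H : hilbertSpace R) (dimH : dim_ge2 H)
    (q : R) (q_gtN1 : -1 < q) (q_le1 : q <= 1)
    (G : fockSpace q H) (f : H) (f_neq0 : f <> 0)
    (Ap : {linear G -> G}) (Ap_creation : is_creation f Ap)
    (A : G -> G) (A_adjoint : is_adjoint Ap A)
    (L : probability (measurableTypeR R) R)
    (L_dist : is_vacuum_distribution (fun x : G => A x + Ap x) L) :
  (q <= 1 / 2 ->
     L `<< (@lebesgue_measure R) /\ is_density_of L (l_density q f)) /\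
  (1 / 2 < q ->
     ~ is_pdf (l_density q f) /\
     forall B : set (measurableTypeR R), measurable B ->
       L B =
       (\int[@lebesgue_measure R]_(x in B) (l_density q f x)%:E +
        ((1 / 2 * (1 - (1 + q) / Num.sqrt (q * (q + 4))))%R)%:E *
        (\d_(- (2 * hnorm f * Num.sqrt (a1 q)))%R B +
         \d_(2 * hnorm f * Num.sqrt (a1 q))%R B))%E).
Proof.
have b_gt0 : 0 < hnorm f ^+ 2.
  rewrite exprn_gt0// -ltcR -hnormE raddf0 normr_gt0; exact/eqP.
have L_pow (n : nat) : L.-integrable setT (EFin \o (fun x : measurableTypeR R => x ^+ n)).
  by have [] := L_dist n.
have expectP := expect_opoly Ap_creation A_adjoint L_dist.
have sqrtb : Num.sqrt (hnorm f ^+ 2) = hnorm f.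
  by rewrite sqrtr_sqr ger0_norm// -ler0c -hnormE.
rewrite l_densityE; split.
  move=> q12.
  have LE (B : set (measurableTypeR R)) : measurable B ->
      L B = (\int[@lebesgue_measure R]_(x in B)
        (spectral_density q (hnorm f ^+ 2) x)%:E)%E.
    move=> mB; have [q_gt0|q_le0] := ltP 0 q; last first.
      exact: (vacuum_law_le0 b_gt0 q_gtN1 q_le1 L_pow expectP).
    rewrite (vacuum_law_gt0 b_gt0 q_gtN1 q_le1 L_pow expectP q_gt0 mB)/=.
    have c2 := root_sqr b_gt0 q_gt0.
    rewrite !(atom_mass0 b_gt0 q_gt0 L_pow expectP) ?sqrrN//.
    by rewrite !mul0e !adde0.
  split.
    apply/null_content_dominatesP => B mB B0; apply: etrans (LE B mB) _.
    apply: null_set_integral => //; apply/measurable_EFinP.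
    by apply: measurable_funTS; exact: measurable_spectral_density.
  split=> //; split.
  - exact: measurable_spectral_density.
  - exact: spectral_density_ge0.
  - by rewrite -LE//; exact: probability_setT.
move=> q12; have q_gt0 : 0 < q by rewrite (lt_trans _ q12).
have c2 := root_sqr b_gt0 q_gt0.
have LE (B : set (measurableTypeR R)) : measurable B ->
    L B = (\int[@lebesgue_measure R]_(x in B)
        (spectral_density q (hnorm f ^+ 2) x)%:E +
      ((1 / 2 * (1 - (1 + q) / Num.sqrt (q * (q + 4))))%R)%:E *
        (\d_(- (2 * hnorm f * Num.sqrt (a1 q)))%R B +
         \d_(2 * hnorm f * Num.sqrt (a1 q))%R B))%E.
  move=> mB; rewrite (vacuum_law_gt0 b_gt0 q_gtN1 q_le1 L_pow expectP q_gt0 mB)/=.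
  rewrite !(atom_mass b_gt0 q_gt0 q_le1 L_pow expectP) ?sqrrN//.
  by rewrite sqrtb -ge0_muleDr.
(* If the density had integral 1, the formula on the whole line would force the weight of the atoms
   to be 0, whereas it is z (1 - z) / (4 z + 2) > 0. *)
split=> // -[_ _ l1].
have z_gt0 := decay_ratio_gt0 q_gt0.
have z_lt1 : decay_ratio q < 1 by rewrite decay_ratio_lt1.
have := LE setT measurableT.
rewrite l1 probability_setT !diracT.
have sum1 (u : R) : (1 + u%:E * (1 + 1) = (1 + u * 2)%:E :> \bar R)%E by [].
rewrite sum1 atom_weightE// => -[e].
have : 0 < decay_ratio q * (1 - decay_ratio q) / (4 * decay_ratio q + 2).
  apply: divr_gt0; first by apply: mulr_gt0 => //; rewrite subr_gt0.
  by apply: addr_gt0 => //; exact: mulr_gt0.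
by move: e; move: (_ / _) => u; lra.
Qed.
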